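(* There is a constant $A_0$ such that for every $A>A_0$ there is a constant $C=C(A)$, depending only on $A$, with the following property. Let $K\subset H$ be any set, let $n_0\in\mathbb{Z}$ satisfy $2^{-n_0}\ge \mathrm{diam}(K)$, let $\{X^K_n\}_{n\ge n_0}$ be a sequence such that $X^K_n$ is a $2^{-n}$-net for $K$ and $X^K_n\subset X^K_{n+1}$ for all $n\ge n_0$, and let $$\hat{\mathcal G}^K=\{\mathrm{Ball}(x,A2^{-n}) : x\in X^K_n,\ n\in\mathbb{Z},\ n\ge n_0\}.$$ Then there exists a connected set $\Gamma_0\subset H$ with $\Gamma_0\supset K$ and $$\mathcal H^1(\Gamma_0)\ \le\ C\Big(\mathrm{diam}(K)+\sum_{Q\in\hat{\mathcal G}^K}\beta_K^2(Q)\,\mathrm{diam}(Q)\Big).$$ In particular, $C$ does not depend on the choice of $\{X^K_n\}_{n\ge n_0}$.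
   Context: $H=\ell_2$ is the separable Hilbert space. $\mathcal H^1$ is one-dimensional Hausdorff measure. $\mathrm{Ball}(x,r)=\{y\in H:\|y-x\|\le r\}$. The parameter $A$ is always $>1$. A set $X$ is an $\epsilon$-net for $K$ if (i) $X\subset K$; (ii) $\|x_1-x_2\|>\epsilon$ for all distinct $x_1,x_2\in X$; (iii) for every $y\in K$ there is $x\in X$ with $\|x-y\|\le\epsilon$. For a set $E\subset H$ and a ball $Q$, the Jones number is $$\beta_E(Q)=\frac{2}{\mathrm{diam}(Q)}\ \inf_{L\text{ line}}\ \sup_{x\in E\cap Q}\mathrm{dist}(x,L),$$ the infimum being over all (affine, one-dimensional) straight lines $L\subset H$. *)

(* Defs.v *)
From HB Require Import structures.
From mathcomp Require Import all_boot all_order all_algebra.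
From mathcomp Require Import all_classical all_reals all_analysis.
From mathcomp Require Import ring lra.

Set Implicit Arguments.
Unset Strict Implicit.
Unset Printing Implicit Defensive.

Import Order.TTheory GRing.Theory Num.Theory.
Import numFieldNormedType.Exports.

Local Open Scope classical_set_scope.
Local Open Scope ring_scope.

Section Ell2.
Context {R : realType}.
Implicit Types u v : nat -> R.

Definition sqseries u : R^nat := series (fun i => u i ^+ 2).

Definition sqsummable : {pred nat -> R} := [pred u | `[< cvgn (sqseries u) >]].

Definition l2norm u : R := Num.sqrt (limn (sqseries u)).

Lemma sqsummableP u : reflect (cvgn (sqseries u)) (u \in sqsummable).
Proof. exact: asboolP. Qed.

Lemma sqseries_ge0 u n : 0 <= sqseries u n.
Proof. by rewrite /sqseries /series /= sumr_ge0// => i _; rewrite sqr_ge0. Qed.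

Lemma sqseries_lim_ge0 u : u \in sqsummable -> 0 <= limn (sqseries u).
Proof.
move=> /sqsummableP cu; apply: limr_ge => //.
by apply: nearW => n; exact: sqseries_ge0.
Qed.

Lemma l2norm_sqr u : u \in sqsummable -> l2norm u ^+ 2 = limn (sqseries u).
Proof. by move=> hu; rewrite sqr_sqrtr// sqseries_lim_ge0. Qed.

Lemma l2norm_ge0 u : 0 <= l2norm u.
Proof. exact: sqrtr_ge0. Qed.

Lemma sqseries_nd u : nondecreasing_seq (sqseries u).
Proof.
apply/nondecreasing_seqP => n; rewrite /sqseries /series /= big_nat_recr//=.
by rewrite lerDl sqr_ge0.
Qed.

Lemma sqseries_le u n : u \in sqsummable -> sqseries u n <= l2norm u ^+ 2.
Proof.
move=> hu; rewrite l2norm_sqr//; apply: nondecreasing_cvgn_le.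
  exact: sqseries_nd.
exact/sqsummableP.
Qed.

Lemma sqsummable_bound u (M : R) : (forall n, sqseries u n <= M) ->
  u \in sqsummable /\ limn (sqseries u) <= M.
Proof.
move=> uM; have cu : cvgn (sqseries u).
  apply: nondecreasing_is_cvgn; first exact: sqseries_nd.
  by exists M => _ [n _ <-].
split; first exact/sqsummableP.
by apply: limr_le => //; apply: nearW.
Qed.

Lemma sqseriesD_le u v (a b : R) n : 0 < a -> 0 < b ->
  sqseries (u + v) n <=
    (1 + b / a) * sqseries u n + (1 + a / b) * sqseries v n.
Proof.
move=> a0 b0; rewrite /sqseries /series /= !big_distrr/= -big_split/=.
apply: ler_sum => i _; rewrite [(u + v) i]/(u i + v i).
have -> : (1 + b / a) * u i ^+ 2 + (1 + a / b) * v i ^+ 2 =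
    (u i + v i) ^+ 2 + (b * u i - a * v i) ^+ 2 / (a * b).
  by field; rewrite !gt_eqF.
by rewrite lerDl divr_ge0 ?sqr_ge0// mulr_ge0// ltW.
Qed.

Lemma sqsummableD_le u v (a b : R) : u \in sqsummable -> v \in sqsummable ->
    l2norm u <= a -> l2norm v <= b -> 0 < a -> 0 < b ->
  u + v \in sqsummable /\ limn (sqseries (u + v)) <= (a + b) ^+ 2.
Proof.
move=> hu hv ua vb a0 b0; apply: sqsummable_bound => n.
apply: (le_trans (sqseriesD_le u v n a0 b0)).
have un : sqseries u n <= a ^+ 2.
  apply: (le_trans (sqseries_le _ hu)).
  by rewrite lerXn2r// nnegrE ?l2norm_ge0// ltW.
have vn : sqseries v n <= b ^+ 2.
  apply: (le_trans (sqseries_le _ hv)).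
  by rewrite lerXn2r// nnegrE ?l2norm_ge0// ltW.
have -> : (a + b) ^+ 2 = (1 + b / a) * a ^+ 2 + (1 + a / b) * b ^+ 2.
  by field; rewrite !gt_eqF.
by rewrite lerD// ler_wpM2l// addr_ge0// divr_ge0// ltW.
Qed.

Lemma sqsummableZ (l : R) u : u \in sqsummable ->
  l *: u \in sqsummable /\ limn (sqseries (l *: u)) = l ^+ 2 * limn (sqseries u).
Proof.
move=> /sqsummableP cu.
have E : sqseries (l *: u) = l ^+ 2 *: sqseries u.
  apply/funext => n; transitivity (l ^+ 2 * sqseries u n) => //.
  rewrite /sqseries /series [LHS]/= mulr_sumr.
  by apply: eq_bigr => i _; rewrite -exprMn.
have cl : (l ^+ 2 *: sqseries u) @ \oo --> l ^+ 2 * limn (sqseries u).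
  exact: cvgZl_tmp.
by rewrite -E in cl; split; [apply/sqsummableP; apply/cvg_ex; eexists; exact: cl
  | exact: cvg_lim cl].
Qed.

Lemma sqsummable0 : 0 \in sqsummable.
Proof.
apply: (sqsummable_bound (M := 0) _).1 => n.
by rewrite /sqseries /series /= big1// => i _; rewrite expr0n.
Qed.

Lemma sqsummable_submod_closed : submod_closed sqsummable.
Proof.
split; first exact: sqsummable0.
move=> l u v hu hv.
have [hl _] := sqsummableZ l hu.
have lt1 w : l2norm w <= l2norm w + 1 by rewrite lerDl.
have gt0 w : 0 < l2norm w + 1 by rewrite ltr_wpDl// l2norm_ge0.
exact: (sqsummableD_le hl hv (lt1 _) (lt1 _) (gt0 _) (gt0 _)).1.
Qed.

HB.instance Definition _ :=
  GRing.isSubmodClosed.Build R (nat -> R) sqsummable sqsummable_submod_closed.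

End Ell2.

Record ell2 (R : realType) := Ell2 {
  ell2_seq :> nat -> R ;
  _ : ell2_seq \in sqsummable }.

Section Ell2Normed.
Context {R : realType}.

HB.instance Definition _ := [isSub for @ell2_seq R].
HB.instance Definition _ := [Choice of ell2 R by <:].
HB.instance Definition _ := [SubChoice_isSubLmodule of ell2 R by <:].

Implicit Types x y : ell2 R.

Definition ell2_norm x : R := l2norm x.

Lemma ell2_normD x y : ell2_norm (x + y) <= ell2_norm x + ell2_norm y.
Proof.
apply/ler_addgt0Pr => e e0; rewrite /ell2_norm [val _]/=.
have e20 : 0 < e / 2 by rewrite divr_gt0.
have lte w : l2norm w <= l2norm w + e / 2 by rewrite lerDl ltW.
have gt0 w : 0 < l2norm w + e / 2 by rewrite ltr_wpDl// l2norm_ge0.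
have [_] := sqsummableD_le (valP x) (valP y) (lte _) (lte _) (gt0 _) (gt0 _).
rewrite -ler_sqrt ?sqr_ge0// sqrtr_sqr ger0_norm; last first.
  by rewrite addr_ge0// ltW.
by move=> /le_trans; apply; rewrite [e in leRHS]splitr /=; lra.
Qed.

Lemma ell2_normZ (l : R) x : ell2_norm (l *: x) = `|l| * ell2_norm x.
Proof.
rewrite /ell2_norm /l2norm [ell2_seq _]/=.
rewrite (sqsummableZ l (valP x)).2.
by rewrite sqrtrM ?sqr_ge0// sqrtr_sqr.
Qed.

Lemma ell2_norm0_eq0 x : ell2_norm x = 0 -> x = 0.
Proof.
move=> x0; apply/val_inj/funext => i /=.
have := sqseries_le i.+1 (valP x); rewrite [l2norm _]x0 expr0n/=.
rewrite /sqseries /series /= big_nat_recr//= => h.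
have : ell2_seq x i ^+ 2 <= 0.
  by apply: le_trans h; rewrite lerDr; exact: sqseries_ge0.
by rewrite -[_ <= 0]andbT -(sqr_ge0 (ell2_seq x i)) -eq_le sqrf_eq0 => /eqP.
Qed.

HB.instance Definition _ := Lmodule_isNormed.Build R (ell2 R)
  ell2_normD ell2_normZ ell2_norm0_eq0.

End Ell2Normed.

Section JonesNumbers.
Context {R : realType} {V : normedModType R}.
Local Open Scope ereal_scope.
Implicit Types (E K L Q X : set V) (x : V).

(* Supremum in [0, +oo]: the supremum of the empty set is 0, not -oo. *)
Definition sup_ge0 (S : set (\bar R)) : \bar R := ereal_sup (0 |` S).

Definition diam E : \bar R :=
  sup_ge0 [set (`|x - y|%R)%:E | x in E & y in E].

Definition hausdorff1_delta (delta : R) E : \bar R :=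
  ereal_inf [set \sum_(0 <= i <oo) diam (F i) |
    F in [set F : (set V)^nat |
      E `<=` \bigcup_i F i /\ forall i, diam (F i) <= delta%:E]].

Definition hausdorff1 E : \bar R :=
  ereal_sup [set hausdorff1_delta delta E | delta in [set d | (0 < d)%R]].

Definition is_line L : Prop :=
  exists p v : V, v != 0%R /\ L = [set (p + t *: v)%R | t in [set: R]].

Definition jones_beta E Q : \bar R :=
  2%:E / diam Q *
  ereal_inf [set sup_ge0 [set edist_inf L x | x in E `&` Q] | L in is_line].

Definition is_net (eps : R) K X : Prop :=
  [/\ X `<=` K,
      forall x1 x2, X x1 -> X x2 -> x1 <> x2 -> (eps < `|x1 - x2|)%R
    & forall y, K y -> exists2 x, X x & (`|x - y| <= eps)%R].

(* A set of balls rather than a family, as the sum runs over distinct balls. *)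
Definition multires (A : R) (n0 : int) (X : int -> set V) : set (set V) :=
  [set Q | exists n x, [/\ (n0 <= n)%R, X n x
    & Q = closed_ball_ Num.norm x (A * 2 ^ (- n))%R]].

End JonesNumbers.

(* Main.v *)
Require Import Defs.
From mathcomp Require Import all_boot all_order all_algebra.
From mathcomp Require Import all_classical all_reals all_analysis.
From mathcomp Require Import ring lra.

Set Implicit Arguments.
Unset Strict Implicit.
Unset Printing Implicit Defensive.

Import Order.TTheory GRing.Theory Num.Theory.
Import numFieldNormedType.Exports.

Local Open Scope classical_set_scope.
Local Open Scope ring_scope.

(** Why the theorem holds. Write [r n] for the scale [2 ^ (- n)], and [beta] for the
Jones number of the ball of radius [A * r n] around a point of the [n]-th net. In
this ball [K] lies in a tube of width about [beta * r n], so by Pythagoras the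
projection to the axis of the tube changes the distances between net points of
scale [n] or [n.+1] by at most a multiple of [beta ^+ 2 * r n]
([jones_coordinate]). A point is called flat if this error is small compared with
[r n]; around it the net points are ordered like points on a line. From there on
the argument is metric: nothing but these coordinates is used.

The graph. At scale [n], two flat net points are joined if no third net point is
closer to both of them ([lune_free]); among points in a tube these are the
consecutive ones. Pairs shorter than [L * r n], with [L] a large constant, are
provisional. At the next scale such a pair is replaced by a chain through the new
points between its ends. When the ends of an interval free of net points are more
than [L * r n] apart, the pair becomes a bridge and is kept for ever. A point that
is not flat has [beta] bounded below and pays [r n] by itself, so around these
points a spanning forest of pairs is kept as well ([repair_forest]).

The length. A chain exceeds the edge it replaces by at most a multiple of
[beta ^+ 2 * r n] ([chain_sum]). The other new edges are near points that are not
flat, or near an end of the graph, a point with no neighbour on one side: there the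
new points can prolong the graph by a multiple of [r n] ([edge_cases]). An end at
scale [n.+1] continues an end at scale [n], or is next to a new bridge
([nends_step]). Prolonging one end at all scales costs a geometric series, that is
a multiple of [r n]; when a bridge creates ends, half of its length, which is at
least [L * r n], pays for them. So the length of the provisional edges plus a
multiple of [r n] times the number of ends is a [potential] whose increase is
controlled by the sum of [beta ^+ 2 * r n], and which moreover pays for half of the
bridges ([potential_step]). The same potential bounds [r n] times the number of net
points ([size_net]). The starting value is of the order of [diam K] if the first
scale is.

The limit. The set is the closure of the union of [K] with all the pairs kept for
ever, drawn as segments ([limit_set]). Balls around the [N]-th net together with the
finitely many segments drawn before stage [N] cover it, which bounds its Hausdorff
measure and shows that it is compact, the Hilbert space being complete. If it were
the union of two separated parts, these would be at a positive distance; but for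
large [N] any two points of the [N]-th net are linked by segments of the set and
steps of length less than [L * r N] ([net_linked]).

The nets are finite when the sum is ([net_finite]): infinitely many points around one
point of the previous net are either all not flat, and contribute infinitely much, or
lie in the tube of one of them, which contains boundedly many. When the sum is
infinite there is nothing to prove. *)

(** * Finite sums, counting and spanning forests *)

Definition pairs (T : Type) (s : seq T) : seq (T * T) :=
  [seq (x, y) | x <- s, y <- s].

Lemma mem_pairs (T : eqType) (s : seq T) (e : T * T) :
  (e \in pairs s) = (e.1 \in s) && (e.2 \in s).
Proof.
case: e => x y; apply/allpairsP/andP => [[[a b] /= [ha hb [-> ->]]]//|[hx hy]].
by exists (x, y).
Qed.

Lemma uniq_pairs (T : eqType) (s : seq T) : uniq s -> uniq (pairs s).
Proof. by move=> us; apply: allpairs_uniq => // -[a b] [c e] _ _ /=. Qed.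

Section Sums.
Context {R : realType}.

Lemma ler_sum_cond (I : eqType) (s : seq I) (P Q : pred I) (f : I -> R) :
  (forall i, 0 <= f i) -> (forall i, i \in s -> P i -> Q i) ->
  \sum_(i <- s | P i) f i <= \sum_(i <- s | Q i) f i.
Proof.
move=> f0 PQ; rewrite big_mkcond [leRHS]big_mkcond big_seq [leRHS]big_seq.
apply: ler_sum => i si; case Pi: (P i); first by rewrite (PQ i).
by case: ifP.
Qed.

(** The form in which costs are charged: every item [i] satisfying [P] has some
creditor [j] in [t], and each creditor pays for all the items related to it.
Several creditors for one item do no harm, as the weights are nonnegative. *)
Lemma charge (I J : eqType) (s : seq I) (t : seq J) (P : pred I) (B : pred J)
    (Q : J -> I -> bool) (w : I -> R) :
  (forall i, 0 <= w i) ->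
  (forall i, i \in s -> P i -> exists j, [/\ j \in t, B j & Q j i]) ->
  \sum_(i <- s | P i) w i <= \sum_(j <- t | B j) \sum_(i <- s | P i && Q j i) w i.
Proof.
move=> w0 PQ; under [leRHS]eq_bigr do rewrite big_mkcondr/=.
rewrite exchange_big/= big_seq_cond [leRHS]big_seq_cond.
apply: ler_sum => i /andP[si Pi]; have [j [jt Bj Qji]] := PQ i si Pi.
rewrite (perm_big _ (perm_to_rem jt)) big_cons Bj Qji lerDl.
by apply: sumr_ge0 => k _; case: ifP.
Qed.

Lemma sum_le_count (I : eqType) (s : seq I) (P : pred I) (w : I -> R) (c N : R) :
  0 <= c -> (forall i, i \in s -> P i -> w i <= c) -> (count P s)%:R <= N ->
  \sum_(i <- s | P i) w i <= N * c.
Proof.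
move=> c0 wc cN; apply: (@le_trans _ _ (\sum_(i <- s | P i) c)).
  rewrite big_seq_cond [leRHS]big_seq_cond.
  by apply: ler_sum => i /andP[si Pi]; apply: wc.
by rewrite big_const_seq iter_addr_0 -mulr_natl ler_wpM2r.
Qed.

Lemma sum1_countR (I : Type) (s : seq I) (P : pred I) :
  \sum_(i <- s | P i) (1 : R) = (count P s)%:R.
Proof. by rewrite big_const_seq iter_addr_0. Qed.

(** Values with gaps at least [delta] fall in different cells of a grid of mesh
[delta]. *)
Lemma count_separated (T : eqType) (s : seq T) (P : pred T) (f : T -> R)
    (c rho delta : R) :
  uniq s -> 0 < delta -> 0 <= rho ->
  (forall p, p \in s -> P p -> `|f p - c| <= rho) ->
  (forall p q, p \in s -> q \in s -> P p -> P q -> p != q ->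
     delta <= `|f p - f q|) ->
  (count P s)%:R <= 2 * rho / delta + 1.
Proof.
move=> us d0 rho0 near sep.
pose g p := Num.truncn ((f p - c + rho) / delta).
pose k := Num.truncn (2 * rho / delta).
have ge0 p : p \in s -> P p -> 0 <= (f p - c + rho) / delta.
  move=> sp Pp; have := near p sp Pp; rewrite ler_norml => /andP[h1 h2].
  by apply: divr_ge0; [lra | exact: ltW].
have ge0' : 0 <= 2 * rho / delta by rewrite divr_ge0 ?(ltW d0) ?mulr_ge0.
have inj : {in [seq p <- s | P p] &, injective g}.
  move=> p q; rewrite !mem_filter => /andP[Pp sp] /andP[Pq sq] gpq.
  apply/eqP; apply: contraT => npq; have := sep p q sp sq Pp Pq npq.
  have /andP[a1 a2] := truncn_itv (ge0 p sp Pp).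
  have /andP[b1 b2] := truncn_itv (ge0 q sq Pq).
  rewrite -/(g p) -/(g q) gpq -!natr1 in a1 a2 b1 b2.
  move: a1 a2 b1 b2; rewrite ler_pdivlMr// ltr_pdivrMr// ler_pdivlMr// ltr_pdivrMr//.
  rewrite !mulrDl !mul1r; set z := _ * delta => a1 a2 b1 b2.
  have : `|f p - f q| < delta by rewrite ltr_norml; lra.
  lra.
have sub : {subset map g [seq p <- s | P p] <= iota 0 k.+1}.
  move=> _ /mapP[p + ->]; rewrite mem_filter => /andP[Pp sp].
  rewrite mem_iota/= add0n ltnS; apply: le_truncn.
  have := near p sp Pp; rewrite ler_norml => /andP[h1 h2].
  by rewrite ler_pM2r ?invr_gt0//; lra.
have := uniq_leq_size _ sub.
rewrite map_inj_in_uniq// filter_uniq// size_map size_iota size_filter => /(_ isT) h.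
apply: (@le_trans _ _ k.+1%:R); first by rewrite ler_nat.
by rewrite -natr1 lerD2r truncn_le.
Qed.

Lemma seq_argmax (I : eqType) (s : seq I) (f : I -> R) (P : pred I) :
  has P s -> exists m, [/\ m \in s, P m & forall i, i \in s -> P i -> f i <= f m].
Proof.
elim: s => //= x s IH; have [/IH[m [ms Pm mm]] _|Ns /=] := boolP (has P s).
  have [Px|NPx] := boolP (P x); last first.
    exists m; split=> //; first by rewrite inE ms orbT.
    by move=> i; rewrite inE => /orP[/eqP->|/mm//]; rewrite (negPf NPx).
  have [h|h] := leP (f m) (f x).
    exists x; split=> //; first exact: mem_head.
    by move=> i; rewrite inE => /orP[/eqP->//|si /(mm _ si)/le_trans]; apply.
  exists m; split=> //; first by rewrite inE ms orbT.
  by move=> i; rewrite inE => /orP[/eqP-> _|/mm//]; exact: ltW.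
rewrite orbF => Px; exists x; split=> //; first exact: mem_head.
move=> i; rewrite inE => /orP[/eqP->//|si Pi].
by case/negP: Ns; apply/hasP; exists i.
Qed.

(** By induction: the interval whose left end is the largest has all the others to
its left, so they share what precedes it. *)
Lemma sum_disjoint_intervals (I : eqType) (s : seq I) (lo hi : I -> R) (a b : R) :
  a <= b -> uniq s ->
  (forall i, i \in s -> [/\ a <= lo i, lo i < hi i & hi i <= b]) ->
  (forall i j, i \in s -> j \in s -> i != j -> hi i <= lo j \/ hi j <= lo i) ->
  \sum_(i <- s) (hi i - lo i) <= b - a.
Proof.
have [n] := ubnP (size s); elim: n => // n IH in s b *.
rewrite ltnS => sn ab us inab dis.
case: (eqVneq s [::]) => [->|/eqP sN0]; first by rewrite big_nil subr_ge0.
have [|m [ms _ mmax]] := @seq_argmax _ s lo predT.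
  by rewrite has_predT lt0n size_eq0; exact/eqP.
rewrite (perm_big _ (perm_to_rem ms)) big_cons /=.
have [am lm mb] := inab m ms.
suff : \sum_(i <- rem m s) (hi i - lo i) <= lo m - a.
  by set S := \sum_(_ <- _) _ => hS; lra.
apply: IH => //; last first.
- by move=> i j /mem_rem si /mem_rem sj; apply: dis.
- move=> i; rewrite (rem_filter _ us) mem_filter /= => /andP[im si].
  have [h1 h2 h3] := inab i si; split=> //.
  by have [//|] := dis i m si ms im; have := mmax i si isT; lra.
- exact: rem_uniq.
- rewrite size_rem//; case: (s) sN0 sn => //.
Qed.

End Sums.

Inductive linked (T : Type) (E : T -> T -> Prop) : T -> T -> Prop :=
| linked0 x : linked E x x
| linkedS x y z : E x y \/ E y x -> linked E y z -> linked E x z.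

Section Linked.
Context {T : Type}.
Implicit Types E : T -> T -> Prop.

Lemma linked1 E x y : E x y -> linked E x y.
Proof. by move=> h; apply: (linkedS (or_introl h)); exact: linked0. Qed.

Lemma linked_trans E x y z : linked E x y -> linked E y z -> linked E x z.
Proof. by elim=> // {}x w v xw _ IH /IH; exact: linkedS. Qed.

Lemma linked_sym E x y : linked E x y -> linked E y x.
Proof.
elim=> [w|{}x w v xw _ IH]; first exact: linked0.
apply: (linked_trans IH); apply: (@linkedS _ _ _ x); last exact: linked0.
by case: xw; [right|left].
Qed.

Lemma linked_sub E E' x y : (forall u v, E u v -> linked E' u v) ->
  linked E x y -> linked E' x y.
Proof.
move=> EE; elim=> [w|{}x w v xw _ IH]; first exact: linked0.
apply: linked_trans IH; case: xw => [/EE//|/EE]; exact: linked_sym.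
Qed.

End Linked.

(** Kruskal's algorithm: [rep] labels the components built so far, and a pair is
kept only if it merges two of them. Hence the pairs kept and the components left
are together at most as many as the points. *)
Lemma spanning_forest (T : eqType) (s : seq T) (l : seq (T * T)) :
  {subset l <= pairs s} ->
  exists t : seq (T * T), [/\ {subset t <= l}, (size t <= size s)%N &
    forall e, e \in l -> linked (fun x y => (x, y) \in t) e.1 e.2].
Proof.
move=> ls; suff [t [rep [tl rs rl el st]]] : exists t (rep : T -> T),
    [/\ {subset t <= l}, forall x, x \in s -> rep x \in s,
      forall x, linked (fun x y => (x, y) \in t) x (rep x),
      forall e, e \in l -> rep e.1 = rep e.2
    & (size t + size (undup (map rep s)) <= size s)%N].
  exists t; split=> //; first exact: leq_trans (leq_addr _ _) st.
  move=> e el0; apply: (linked_trans (rl _)); rewrite (el _ el0).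
  exact/linked_sym/rl.
elim: l ls => [|[x y] l IH] ls.
  exists [::], id; split=> //; first by move=> x; exact: linked0.
  by rewrite map_id add0n size_undup.
have [|t [rep [tl rs rl el st]]] := IH.
  by move=> e h; apply: ls; rewrite inE h orbT.
have [xs ys] : x \in s /\ y \in s.
  by apply/andP; have := ls (x, y) (mem_head _ _); rewrite mem_pairs.
have [xy|xy] := eqVneq (rep x) (rep y).
  exists t, rep; split=> //.
    by move=> e h; rewrite inE tl ?orbT.
  by move=> e; rewrite inE => /orP[/eqP->//|/el].
have mono u v : linked (fun a b => (a, b) \in t) u v ->
    linked (fun a b => (a, b) \in (x, y) :: t) u v.
  by apply: linked_sub => a b h; apply: linked1; rewrite inE h orbT.
exists ((x, y) :: t), (fun z => if rep z == rep y then rep x else rep z); split.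
- by move=> e; rewrite !inE => /orP[->//|/tl->]; rewrite orbT.
- by move=> z zs; case: ifP => _; exact: rs.
- move=> z; case: ifPn => [/eqP zy|_]; last exact/mono/rl.
  apply: (linked_trans (mono _ _ (rl z))); rewrite zy.
  apply: (linked_trans (linked_sym (mono _ _ (rl y)))).
  apply: (@linked_trans _ _ _ x); last exact/mono/rl.
  by apply/linked_sym/linked1; rewrite mem_head.
- move=> e; rewrite inE => /orP[/eqP->|/el ->//] /=.
  by rewrite eqxx (negPf xy).
- apply: leq_trans st; rewrite /= addSn -addnS leq_add2l.
  set u := undup _; set v := undup _.
  have ryv : rep y \in v by rewrite mem_undup map_f.
  have : (size u <= size (rem (rep y) v))%N.
    apply: uniq_leq_size; first exact: undup_uniq.
    move=> z; rewrite mem_undup (rem_filter _ (undup_uniq _)) mem_filter mem_undup /=.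
    move=> /mapP[w ws ->]; case: ifPn => [_|h].
      by rewrite xy map_f.
    by rewrite h map_f.
  rewrite size_rem//; case: (v) ryv => //.
Qed.

(** * Charts and proximity graphs on a chain of nets *)

(** The points of [s] in a ball are almost on a line: [pi] is their coordinate along
it. The error is one-sided, since a projection does not increase distances. *)
Definition chart (R : realType) (V : eqType) (d : V -> V -> R) (s : seq V) (x : V)
    (rho e : R) (pi : V -> R) : Prop :=
  forall p q, p \in s -> q \in s -> d x p <= rho -> d x q <= rho ->
    `|pi p - pi q| <= d p q /\ d p q <= `|pi p - pi q| + e.

Section Nets.
Context {R : realType} {V : eqType} (d : V -> V -> R).
Context (xs : nat -> seq V) (r : nat -> R) (eta : nat -> V -> R) (A L : R).

(** [eta n x] stands for a large multiple of the squared Jones number of the ball of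
radius [A * r n] around [x]. The threshold makes the error of a chart small
compared with the gaps between net points. *)
Definition flat n x := eta n x < 1 / 8.

(** The relative neighbourhood graph: two points are joined unless a third one is
closer to both of them than they are to each other. Among points that are almost
on a line these are the pairs of consecutive points, but the definition needs
no line and is the same in all charts. *)
Definition lune_free (s : seq V) (e : V * V) :=
  all (fun z => (d e.1 e.2 <= d e.1 z) || (d e.1 e.2 <= d z e.2)) s.

Definition rng n (e : V * V) :=
  [&& e.1 != e.2, flat n e.1, flat n e.2 & lune_free (xs n) e].

Definition short_edge n e := rng n e && (d e.1 e.2 < L * r n).

Definition long_edge n (e : V * V) :=
  [&& rng n e, L * r n <= d e.1 e.2 & d e.1 e.2 < 2 * L * r n].

(** A gap of [xs m] that has been bridged is still a gap of [xs m.+1], with end points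
that may have moved by [2 * r m]; it must not be bridged a second time. *)
Definition parallel n (e g : V * V) :=
  (d e.1 g.1 <= 2 * r n) && (d e.2 g.2 <= 2 * r n).

Fixpoint bridges n : seq (V * V) :=
  if n is m.+1 then
    [seq e <- pairs (xs m.+1) | long_edge m.+1 e && ~~ has (parallel m e) (bridges m)]
  else [::].

(** Short edges are provisional, they are replaced at the next scale. Once the points
next to a gap are [L * r n] apart, the gap is bridged for good. *)
Definition edge n e := short_edge n e || (e \in bridges n).

Definition nbrs n u := [seq v <- xs n | (v != u) && (d u v < L * r n)].

(** [u] lies between [v] and [w], expressed through distances in order not to depend
on a chart. *)
Definition opposite u v w := (d u v < d v w) && (d u w < d v w).

(** The number of sides of [u] on which no point is closer than [L * r n]: an isolated
point has two such sides, and otherwise all neighbours are on one side or not. *)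
Definition ends n u : nat :=
  if nbrs n u is [::] then 2
  else ~~ has (fun v => has (opposite u v) (nbrs n u)) (nbrs n u).

(** [e] lies along [g] with the same orientation. *)
Definition between (g e : V * V) :=
  [&& d g.1 e.1 <= d g.1 g.2, d e.1 g.2 <= d g.1 g.2,
      d g.1 e.2 <= d g.1 g.2, d e.2 g.2 <= d g.1 g.2,
      d g.1 e.1 < d g.1 e.2 & d e.2 g.2 < d e.1 g.2].

Hypotheses (d0 : forall x, d x x = 0) (dC : forall x y, d x y = d y x).
Hypothesis dT : forall y x z, d x z <= d x y + d y z.
Hypotheses (r_gt0 : forall n, 0 < r n) (rS : forall n, r n.+1 = r n / 2).
Hypothesis xs_uniq : forall n, uniq (xs n).
Hypothesis xs_sub : forall n, {subset xs n <= xs n.+1}.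
Hypothesis xs_sep : forall n x y, x \in xs n -> y \in xs n -> x != y -> r n < d x y.
Hypothesis xs_cov : forall n y, y \in xs n.+1 -> exists2 x, x \in xs n & d y x <= r n.
Hypothesis xs0 : exists x, xs 0 = [:: x].
Hypothesis eta_ge0 : forall n x, 0 <= eta n x.
Hypothesis charts : forall n x e, x \in xs n -> eta n x < e ->
  exists pi, chart d (xs n.+1) x (A * r n) (e * r n) pi.
Hypotheses (HL : 20 <= L) (HA : 40 * L <= A).

Let d_ge0 x y : 0 <= d x y.
Proof. by have := dT y x x; rewrite d0 (dC y x); lra. Qed.

Let Lr n : 20 * r n <= L * r n.
Proof. by rewrite ler_wpM2r// ltW. Qed.

Let Ar n : 8 * (L * r n) <= A * r n.
Proof.
rewrite mulrA ler_wpM2r// ?ltW//; have := HL; have := HA; lra.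
Qed.

Lemma lune_freeC s u v : lune_free s (u, v) = lune_free s (v, u).
Proof.
apply: eq_all => z /=; rewrite orbC (dC u v) (dC z v) (dC u z).
by [].
Qed.

Lemma rngC n u v : rng n (u, v) = rng n (v, u).
Proof. by rewrite /rng /= lune_freeC eq_sym; congr (_ && _); rewrite andbCA. Qed.

Lemma short_edgeC n u v : short_edge n (u, v) = short_edge n (v, u).
Proof. by rewrite /short_edge rngC /= dC. Qed.

Lemma long_edgeC n u v : long_edge n (u, v) = long_edge n (v, u).
Proof. by rewrite /long_edge rngC /= dC. Qed.

Lemma bridgesC n u v : ((u, v) \in bridges n) = ((v, u) \in bridges n).
Proof.
elim: n u v => //= n IH u v; rewrite !mem_filter long_edgeC !mem_pairs /= andbC.
rewrite [in RHS]andbC [(v \in _) && _]andbC; congr (_ && (_ && ~~ _)).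
by apply/hasP/hasP => -[[a b] h /andP[/= h1 h2]]; exists (b, a);
  rewrite -1?IH// /parallel /= h1 h2.
Qed.

Lemma edgeC n u v : edge n (u, v) = edge n (v, u).
Proof. by rewrite /edge short_edgeC bridgesC. Qed.

Lemma mem_bridges n e : e \in bridges n -> e \in pairs (xs n) /\ long_edge n e.
Proof. by case: n => // n; rewrite mem_filter => /andP[/andP[]]. Qed.

Lemma edge_rng n e : edge n e -> rng n e /\ d e.1 e.2 < 2 * L * r n.
Proof.
case/orP => [/andP[h1 h2]|/mem_bridges[_ /and3P[]//]]; split=> //.
by apply: lt_le_trans h2 _; have := Lr n; have := r_gt0 n; lra.
Qed.

(** Two consecutive scales seen in a chart [pi] around a point [w]. Net points are
more than [r n / 2] apart and the error is [r n / 8], so the order given by [pi]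
decides which points lie in the lune of a pair. *)
Section InChart.
Context (n : nat) (w : V) (pi : V -> R).
Hypothesis chart_pi : chart d (xs n.+1) w (A * r n) (r n / 8) pi.

Let inb p := (p \in xs n.+1) && (d w p <= A * r n).

Lemma chart_le p q : inb p -> inb q -> pi p <= pi q ->
  pi q - pi p <= d p q <= pi q - pi p + r n / 8.
Proof.
move=> /andP[ps wp] /andP[qs wq] pq.
have [] := chart_pi ps qs wp wq; rewrite distrC ger0_norm ?subr_ge0//.
by move=> -> ->.
Qed.

Lemma chart_gap p q : inb p -> inb q -> p != q -> pi p <= pi q ->
  pi p + 3 / 8 * r n < pi q.
Proof.
move=> ip iq pq le; have /andP[_ h] := chart_le ip iq le.
have /andP[ps _] := ip; have /andP[qs _] := iq.
by have := xs_sep ps qs pq; rewrite rS; lra.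
Qed.

Lemma chart_gap_coarse p q : inb p -> inb q -> p \in xs n -> q \in xs n ->
  p != q -> pi p <= pi q -> pi p + 7 / 8 * r n < pi q.
Proof.
move=> ip iq ps qs pq le; have /andP[_ h] := chart_le ip iq le.
by have := xs_sep ps qs pq; lra.
Qed.

Lemma chart_lune p q z : inb p -> inb q -> inb z -> pi p < pi q ->
  d p z < d p q -> d z q < d p q -> pi p < pi z /\ pi z < pi q.
Proof.
move=> ip iq iz pq h1 h2.
have /andP[a1 a2] := chart_le ip iq (ltW pq).
have zp : z != p by apply: contraTneq h2 => ->; rewrite ltxx.
have zq : z != q by apply: contraTneq h1 => ->; rewrite ltxx.
have [zlep|plz] := leP (pi z) (pi p).
  have /andP[b1 b2] := chart_le iz iq (le_trans zlep (ltW pq)).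
  by have := chart_gap iz ip zp zlep; have := r_gt0 n; lra.
have [qlez|zlq] := leP (pi q) (pi z).
  have /andP[b1 b2] := chart_le ip iz (le_trans (ltW pq) qlez).
  have qz : q != z by rewrite eq_sym.
  by have := chart_gap iq iz qz qlez; have := r_gt0 n; lra.
by [].
Qed.

Lemma lune_chart p q z : inb p -> inb q -> inb z -> pi p < pi z -> pi z < pi q ->
  d p z < d p q /\ d z q < d p q.
Proof.
move=> ip iq iz pz zq.
have /andP[a1 a2] := chart_le ip iq (ltW (lt_trans pz zq)).
have /andP[b1 b2] := chart_le ip iz (ltW pz).
have /andP[c1 c2] := chart_le iz iq (ltW zq).
have npz : p != z by apply: contraTneq pz => ->; rewrite ltxx.
have nzq : z != q by apply: contraTneq zq => ->; rewrite ltxx.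
have := chart_gap ip iz npz (ltW pz); have := chart_gap iz iq nzq (ltW zq).
have := r_gt0 n; lra.
Qed.

(** In a chart, points on different sides of [u] are opposite and points on the same
side are not. *)
Lemma chart_ends m u : inb u -> (forall v, v \in nbrs m u -> inb v) ->
  ends m u = (~~ has (fun v => (pi u < pi v)%R) (nbrs m u) +
              ~~ has (fun v => (pi v < pi u)%R) (nbrs m u))%N.
Proof.
move=> iu iN; have r0 := r_gt0 n.
have side v : v \in nbrs m u -> pi u + 3 / 8 * r n < pi v \/ pi v + 3 / 8 * r n < pi u.
  move=> vN; have iv := iN v vN; move: vN; rewrite mem_filter => /andP[/andP[vu _] _].
  have [h|h] := leP (pi u) (pi v); [left|right].
    by rewrite eq_sym in vu; exact: (chart_gap iu iv).
  exact: (chart_gap iv iu vu (ltW h)).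
have opp v v' : v \in nbrs m u -> v' \in nbrs m u ->
    pi u < pi v -> opposite u v v' = (pi v' < pi u).
  move=> vN v'N uv; have iv := iN v vN; have iv' := iN v' v'N.
  have {}uv : pi u + 3 / 8 * r n < pi v by case: (side v vN) => //; lra.
  have /andP[a1 a2] := chart_le iu iv ltac:(lra).
  case: (side v' v'N) => uv'.
    rewrite (ltNge (pi v')) [pi u <= _]ltW ?andbF; last by lra.
    apply/negbTE/negP => /andP[h1 h2].
    have /andP[b1 b2] := chart_le iu iv' ltac:(lra).
    have [vv|vv] := leP (pi v) (pi v').
      by have /andP[c1 c2] := chart_le iv iv' vv; lra.
    by have := chart_le iv' iv (ltW vv); rewrite dC => /andP[c1 c2]; lra.
  have := chart_le iv' iu ltac:(lra); rewrite dC => /andP[b1 b2].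
  have := chart_le iv' iv ltac:(lra); rewrite dC => /andP[c1 c2].
  rewrite [RHS](_ : _ = true); last by lra.
  by apply/andP; split; lra.
have oppC v v' : opposite u v v' = opposite u v' v.
  by rewrite /opposite andbC (dC v).
rewrite /ends; case E: (nbrs m u) => [//|x t]; rewrite -E.
have xN : x \in nbrs m u by rewrite E mem_head.
have -> : has (fun v => has (opposite u v) (nbrs m u)) (nbrs m u) =
   has (fun v => pi u < pi v) (nbrs m u) && has (fun v => pi v < pi u) (nbrs m u).
  apply/idP/idP.
    move=> /hasP[v vN /hasP[v' v'N o]].
    case: (side v vN) => uv.
      rewrite opp// in o; last by lra.
      by apply/andP; split; apply/hasP; [exists v => //; lra|exists v'].
    case: (side v' v'N) => uv'.
      by apply/andP; split; apply/hasP; [exists v' => //; lra|exists v => //; lra].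
    exfalso; move: o; rewrite /opposite => /andP[h1 h2].
    have iv := iN v vN; have iv' := iN v' v'N.
    have := chart_le iv iu ltac:(lra); rewrite dC => /andP[a1 a2].
    have := chart_le iv' iu ltac:(lra); rewrite dC => /andP[b1 b2].
    have [vv|vv] := leP (pi v) (pi v').
      by have /andP[c1 c2] := chart_le iv iv' vv; lra.
    by have := chart_le iv' iv (ltW vv); rewrite dC => /andP[c1 c2]; lra.
  move=> /andP[/hasP[v vN uv] /hasP[v' v'N uv']].
  by apply/hasP; exists v => //; apply/hasP; exists v' => //; rewrite opp.
have : has (fun v => pi u < pi v) (nbrs m u) || has (fun v => pi v < pi u) (nbrs m u).
  by case: (side x xN) => h; apply/orP; [left|right]; apply/hasP; exists x => //; lra.
by case: (has _ _); case: (has _ _).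
Qed.

End InChart.

(** A long pair is suppressed only if it runs along an older bridge, and the bridges
of the previous scale are at least [2 * L * r n] long, too long for that here. *)
Lemma long_bridge n a b : a \in xs n -> b \in xs n -> rng n (a, b) ->
  L * r n <= d a b -> d a b <= (L + 3) * r n -> (a, b) \in bridges n.
Proof.
move=> As bs ab lo hi; have r0 := r_gt0 n; have lr := Lr n.
have le : long_edge n (a, b) by rewrite /long_edge ab lo /=; lra.
case: n As bs ab lo hi le r0 lr => [|n] As bs ab lo hi le r0 lr.
  by case: xs0 As bs ab => x -> ; rewrite !inE => /eqP-> /eqP->; rewrite /rng eqxx.
rewrite mem_filter mem_pairs As bs le /= andbT; apply/hasPn => -[g h].
move=> /mem_bridges[_ /and3P[_ + _]] /=; rewrite /parallel /=.
apply: contraL => /andP[ag bh]; rewrite -ltNge; rewrite !rS in lo hi lr ag bh *.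
by have := dT a g h; have := dT b a h; rewrite (dC g a); have := r_gt0 n; lra.
Qed.


Lemma chartN s w rho e pi : chart d s w rho e pi ->
  chart d s w rho e (fun x => - pi x).
Proof.
move=> c p q ps qs wp wq; have := c p q ps qs wp wq.
by rewrite -opprD normrN.
Qed.

Lemma flat_chart n x : x \in xs n -> flat n x ->
  exists pi, chart d (xs n.+1) x (A * r n) (r n / 8) pi.
Proof.
by move=> xn fx; have [pi c] := charts xn fx; exists pi; rewrite -[_ / 8]mulrC -div1r.
Qed.

(** An edge [(u, v)] of the finer graph, oriented along a chart in which all the coarse
points nearby are flat. *)
Section EdgeStep.
Context (n : nat) (w u v : V) (pi : V -> R).
Hypothesis chart_pi : chart d (xs n.+1) w (A * r n) (r n / 8) pi.
Hypotheses (ws : w \in xs n.+1) (us : u \in xs n.+1) (vs : v \in xs n.+1) (uv :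
  pi u < pi v).
Hypothesis uv_edge : edge n.+1 (u, v).
Hypotheses (wu : d w u <= (L + 1) * r n) (wv : d w v <= (L + 1) * r n).
Hypothesis flats : forall y, y \in xs n -> d w y <= 4 * L * r n -> flat n y.

Let inb p := (p \in xs n.+1) && (d w p <= A * r n).

Let uv_lt : d u v < L * r n.
Proof. by have [_] := edge_rng uv_edge; rewrite rS /=; lra. Qed.

Let inbP p : p \in xs n -> d w p <= 5 * L * r n -> inb p.
Proof.
by move=> ps h; rewrite /inb xs_sub//=; have := Ar n; have := Lr n; have := r_gt0 n; lra.
Qed.

Let inb_u : inb u.
Proof. by have := wu; rewrite /inb us /=; have := Ar n; have := Lr n; have := r_gt0 n;
  lra. Qed.

Let inb_v : inb v.
Proof. by have := wv; rewrite /inb vs /=; have := Ar n; have := Lr n; have := r_gt0 n;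
  lra. Qed.

(** A coarse point is also a fine one, so none projects between [u] and [v]: those
nearby are split into the ones before [u] and the ones after [v]. *)
Let no_middle z : z \in xs n -> d w z <= 5 * L * r n -> pi z <= pi u \/ pi v <= pi z.
Proof.
move=> zs wz; have [//|uz] := leP (pi z) (pi u); first by left.
have [//|zv] := leP (pi v) (pi z); first by right.
have [/and4P[_ _ _ /allP/(_ z (xs_sub zs))/=]] := edge_rng uv_edge.
have [h1 h2] := lune_chart chart_pi inb_u inb_v (inbP zs wz) uz zv.
by rewrite !leNgt h1 h2.
Qed.

Let lastL a := [/\ a \in xs n, d w a <= 3 * L * r n, pi a <= pi u &
  forall z, z \in xs n -> d w z <= 3 * L * r n -> pi z <= pi u -> pi z <= pi a].

Let firstR b := [/\ b \in xs n, d w b <= 3 * L * r n, pi v <= pi b &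
  forall z, z \in xs n -> d w z <= 3 * L * r n -> pi v <= pi z -> pi b <= pi z].

Lemma lastL_ex p : p \in xs n -> d w p <= 3 * L * r n -> pi p <= pi u ->
  exists a, lastL a.
Proof.
move=> ps wp pu.
have [|a [am /andP[a1 a2] aM]] := @seq_argmax R _ (xs n) pi
    (fun z => (d w z <= 3 * L * r n) && (pi z <= pi u)).
  by apply/hasP; exists p => //; rewrite wp pu.
by exists a; split=> // z zs h1 h2; apply: aM => //; rewrite h1 h2.
Qed.

Lemma firstR_ex p : p \in xs n -> d w p <= 3 * L * r n -> pi v <= pi p ->
  exists b, firstR b.
Proof.
move=> ps wp pu.
have [|a [am /andP[a1 a2] aM]] := @seq_argmax R _ (xs n) (fun z => - pi z)
    (fun z => (d w z <= 3 * L * r n) && (pi v <= pi z)).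
  by apply/hasP; exists p => //; rewrite wp pu.
by exists a; split=> // z zs h1 h2; rewrite -lerN2; apply: aM => //; rewrite h1 h2.
Qed.

Lemma enclosing_rng a b : lastL a -> firstR b -> d a b <= (L + 3) * r n ->
  rng n (a, b) /\ between (a, b) (u, v).
Proof.
move=> [As wa au amax] [bs wb vb bmin] ab.
have r0 := r_gt0 n; have lr := Lr n; have uvP := uv.
have ia : inb a by apply: inbP => //; lra.
have ib : inb b by apply: inbP => //; lra.
have piab : pi a < pi b by lra.
have /andP[ab1 ab2] := chart_le chart_pi ia ib (ltW piab).
have le_side p q z : inb p -> inb q -> inb z -> pi p <= pi z -> pi z <= pi q ->
    d p z <= d p q /\ d z q <= d p q.
  move=> ip iq iz pz zq.
  have [->|zp] := eqVneq z p; first by rewrite d0.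
  have [->|nzq] := eqVneq z q; first by rewrite d0.
  have pzp : p != z by rewrite eq_sym.
  have h1 := chart_gap chart_pi ip iz pzp pz.
  have h2 := chart_gap chart_pi iz iq nzq zq.
  have [] := lune_chart chart_pi ip iq iz; [lra|lra|].
  by split; exact: ltW.
have [au1 au2] := le_side a b u ia ib inb_u au ltac:(lra).
have [av1 av2] := le_side a b v ia ib inb_v ltac:(lra) vb.
have nuv : u != v by apply: contraTneq uv => ->; rewrite ltxx.
have gap := chart_gap chart_pi inb_u inb_v nuv (ltW uv).
split; last first.
  have /andP[_ c2] := chart_le chart_pi ia inb_u au.
  have /andP[e1 _] := chart_le chart_pi ia inb_v ltac:(lra).
  have /andP[_ f2] := chart_le chart_pi inb_v ib vb.
  have /andP[g1 _] := chart_le chart_pi inb_u ib ltac:(lra).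
  by rewrite /between /= au1 au2 av1 av2 /=; apply/andP; split; lra.
apply/and4P; split=> /=.
- by apply: contraTneq piab => ->; rewrite ltxx.
- by apply: flats => //; lra.
- by apply: flats => //; lra.
apply/allP => z zs /=; rewrite !leNgt -negb_and; apply/negP => /andP[az zb].
have wz : d w z <= 5 * L * r n by have := dT a w z; lra.
have iz := inbP zs wz.
have [az' zb'] := chart_lune chart_pi ia ib iz piab az zb.
have iw : inb w.
  by rewrite /inb ws d0 /=; have := Ar n; lra.
have wz2 : d w z <= 3 * L * r n.
  have naz : a != z by apply: contraTneq az' => ->; rewrite ltxx.
  have nzb : z != b by apply: contraTneq zb' => ->; rewrite ltxx.
  have g1 := chart_gap chart_pi ia iz naz (ltW az').
  have g2 := chart_gap chart_pi iz ib nzb (ltW zb').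
  have [wz'|zw'] := leP (pi w) (pi z).
    have /andP[_ c2] := chart_le chart_pi iw iz wz'.
    have /andP[e1 _] := chart_le chart_pi iw ib ltac:(lra).
    lra.
  have /andP[_ c2] := chart_le chart_pi iz iw (ltW zw').
  have /andP[e1 _] := chart_le chart_pi ia iw ltac:(lra).
  by rewrite (dC w z); rewrite (dC w a) in wa; lra.
by have := no_middle zs wz; move=> [zu|vz];
  [have := amax z zs wz2 zu|have := bmin z zs wz2 vz]; lra.
Qed.

Let ends_posR a : a \in xs n -> d w a <= 3 * L * r n ->
  (forall c, c \in nbrs n a -> pi c <= pi a) -> (0 < ends n a)%N.
Proof.
move=> As wa ac; have r0 := r_gt0 n; have lr := Lr n.
have ia : inb a by apply: inbP => //; lra.
rewrite (chart_ends chart_pi ia) => [|c].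
  rewrite (_ : has _ _ = false)//; apply/negbTE/hasPn => c /ac.
  by rewrite leNgt.
rewrite mem_filter => /andP[/andP[_ ca] cs]; apply: inbP => //.
by have := dT a w c; lra.
Qed.

Definition enclosed := exists g, [/\ g \in pairs (xs n), short_edge n g & between g (u, v)].

Definition near_end := exists a,
  [/\ a \in xs n, flat n a, (0 < ends n a)%N, d u a <= 2 * r n & d v a <= 2 * r n].

(** Both coarse parents lie before the edge. Then so does [a], the last coarse point
before [u], and the edge is within [2 * r n] of it. Either the next coarse point
[b] is close enough for [(a, b)] to be a short edge enclosing [(u, v)], or nothing
follows [a] and it is an end. *)
Lemma parents_left p q : p \in xs n -> d u p <= r n -> pi p <= pi u ->
  q \in xs n -> d v q <= r n -> pi q <= pi u -> enclosed \/ near_end.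
Proof.
move=> ps up piu qs vq qiu; have r0 := r_gt0 n; have lr := Lr n; have uvP := uv.
have [wuP wvP] := (wu, wv).
have wq : d w q <= (L + 2) * r n by have := dT v w q; lra.
have [a [As wa au amax]] : exists a, lastL a by apply: (lastL_ex qs) => //; lra.
have iq : inb q by apply: inbP => //; lra.
have ia : inb a by apply: inbP => //; lra.
have qa : pi q <= pi a by apply: amax => //; lra.
have := chart_le chart_pi iq inb_v ltac:(lra); rewrite dC => /andP[e1 _].
have := chart_le chart_pi ia inb_v ltac:(lra); rewrite dC => /andP[_ f2].
have := chart_le chart_pi ia inb_u au; rewrite dC => /andP[_ g2].
have wa2 : d w a <= (L + 3) * r n by have := dT u w a; lra.
have [/hasP[c cN ac]|hN] := boolP (has (fun c => pi a < pi c) (nbrs n a)).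
  left; move: cN; rewrite mem_filter => /andP[/andP[ca dac] cs].
  have wc : d w c <= 3 * L * r n by have := dT a w c; lra.
  case: (no_middle cs ltac:(lra)) => [cu|vc].
    by have := amax c cs wc cu; lra.
  have [b [bs wb vb bmin]] := firstR_ex cs wc vc.
  have bc : pi b <= pi c by apply: bmin.
  have ib : inb b by apply: inbP => //; lra.
  have ic : inb c by apply: inbP => //; lra.
  have dab : d a b < L * r n.
    have [->//|nbc] := eqVneq b c.
    have := chart_gap_coarse chart_pi ib ic bs cs nbc bc.
    have /andP[_ h2] := chart_le chart_pi ia ib ltac:(lra).
    have /andP[k1 _] := chart_le chart_pi ia ic (ltW ac).
    lra.
  have [] := @enclosing_rng a b; [by []|by []|lra|].
  move=> rab bt; exists (a, b); split=> //; first by rewrite mem_pairs As bs.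
  by rewrite /short_edge rab.
right; exists a; split=> //.
- by apply: flats => //; lra.
- apply: ends_posR => // c cN; rewrite leNgt.
  by apply: contraNN hN => ac; apply/hasP; exists c.
- lra.
- lra.
Qed.

(** The parents are on the two sides. If the coarse pair [(a, b)] around the edge is
not a short edge, it is a bridge: then [(u, v)] is too long for a short edge, and
it is not a bridge either, because it is parallel to [(a, b)]. *)
Lemma parents_around p q : p \in xs n -> d u p <= r n -> pi p <= pi u ->
  q \in xs n -> d v q <= r n -> pi v <= pi q -> enclosed.
Proof.
move=> ps up piu qs vq qiv; have r0 := r_gt0 n; have lr := Lr n; have uvP := uv.
have [wuP wvP] := (wu, wv).
have wp : d w p <= (L + 2) * r n by have := dT u w p; lra.
have wq : d w q <= (L + 2) * r n by have := dT v w q; lra.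
have [a la] : exists a, lastL a by apply: (lastL_ex ps) => //; lra.
have [b lb] : exists b, firstR b by apply: (firstR_ex qs) => //; lra.
have [As wa au amax] := la; have [bs wb vb bmin] := lb.
have ip : inb p by apply: inbP => //; lra.
have iq : inb q by apply: inbP => //; lra.
have ia : inb a by apply: inbP => //; lra.
have ib : inb b by apply: inbP => //; lra.
have pa : pi p <= pi a by apply: amax => //; lra.
have bq : pi b <= pi q by apply: bmin => //; lra.
have /andP[_ h2] := chart_le chart_pi ia ib ltac:(lra).
have := chart_le chart_pi ip inb_u piu; rewrite dC => /andP[e1 _].
have /andP[f1 _] := chart_le chart_pi inb_v iq qiv.
have /andP[g1 _] := chart_le chart_pi inb_u inb_v (ltW uv).
have := chart_le chart_pi ia inb_u au; rewrite dC => /andP[_ k2].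
have /andP[_ l2] := chart_le chart_pi inb_v ib vb.
have uvl := uv_lt.
have [] := @enclosing_rng a b la lb; first by lra.
move=> rab bt; have [dab|dab] := ltP (d a b) (L * r n).
  exists (a, b); split=> //; first by rewrite mem_pairs As bs.
  by rewrite /short_edge rab.
have bab : (a, b) \in bridges n by apply: long_bridge => //; lra.
exfalso; case/orP: uv_edge => [/andP[_]|].
  by rewrite rS /=; lra.
rewrite mem_filter => /andP[/andP[_ /hasPn/(_ _ bab)]].
by rewrite /parallel /= => /negP[]; apply/andP; split; lra.
Qed.

(** Each parent is beyond the other end of the edge, so the edge is at most [r n] long
in the chart, and the enclosing pair is short as well. *)
Lemma parents_crossed p q : p \in xs n -> d u p <= r n -> pi v <= pi p ->
  q \in xs n -> d v q <= r n -> pi q <= pi u -> enclosed.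
Proof.
move=> ps up piv qs vq qiu; have r0 := r_gt0 n; have lr := Lr n; have uvP := uv.
have [wuP wvP] := (wu, wv).
have wp : d w p <= (L + 2) * r n by have := dT u w p; lra.
have wq : d w q <= (L + 2) * r n by have := dT v w q; lra.
have [a la] : exists a, lastL a by apply: (lastL_ex qs) => //; lra.
have [b lb] : exists b, firstR b by apply: (firstR_ex ps) => //; lra.
have [As wa au amax] := la; have [bs wb vb bmin] := lb.
have ip : inb p by apply: inbP => //; lra.
have iq : inb q by apply: inbP => //; lra.
have ia : inb a by apply: inbP => //; lra.
have ib : inb b by apply: inbP => //; lra.
have qa : pi q <= pi a by apply: amax => //; lra.
have bp : pi b <= pi p by apply: bmin => //; lra.
have /andP[_ h2] := chart_le chart_pi ia ib ltac:(lra).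
have /andP[e1 _] := chart_le chart_pi inb_u ip ltac:(lra).
have := chart_le chart_pi iq inb_v ltac:(lra); rewrite dC => /andP[f1 _].
have [] := @enclosing_rng a b la lb; first by lra.
move=> rab bt; exists (a, b); split=> //; first by rewrite mem_pairs As bs.
by rewrite /short_edge rab /=; lra.
Qed.

Lemma parents_step p q : p \in xs n -> d u p <= r n -> q \in xs n -> d v q <= r n ->
  [\/ enclosed, near_end | pi v <= pi p /\ pi v <= pi q].
Proof.
move=> ps up qs vq; have r0 := r_gt0 n; have lr := Lr n.
have [wuP wvP] := (wu, wv).
have wp : d w p <= 3 * L * r n by have := dT u w p; lra.
have wq : d w q <= 3 * L * r n by have := dT v w q; lra.
case: (no_middle ps ltac:(lra)) (no_middle qs ltac:(lra)) => hp [] hq.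
- by case: (parents_left ps up hp qs vq hq); [apply: Or31|apply: Or32].
- by apply: Or31; exact: (parents_around ps up hp qs vq hq).
- by apply: Or31; exact: (parents_crossed ps up hp qs vq hq).
- by apply: Or33.
Qed.

End EdgeStep.


Lemma enclosedC n u v : enclosed n u v -> enclosed n v u.
Proof.
move=> [[a b] [+ ab /and5P[/= h1 h2 h3 h4 /andP[h5 h6]]]].
rewrite mem_pairs andbC => gs; exists (b, a); split; first by rewrite mem_pairs.
  by rewrite short_edgeC.
by rewrite /between /= (dC b a) (dC b u) (dC b v) (dC u a) (dC v a); apply/and5P;
  split; rewrite // h6.
Qed.

Lemma near_endC n u v : near_end n u v -> near_end n v u.
Proof. by move=> [a [h1 h2 h3 h4 h5]]; exists a. Qed.

(** The case left open by [parents_step] is the mirror image of [parents_left]. *)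
Lemma edge_step n w u v p q pi : chart d (xs n.+1) w (A * r n) (r n / 8) pi ->
  w \in xs n.+1 -> u \in xs n.+1 -> v \in xs n.+1 -> pi u < pi v ->
  edge n.+1 (u, v) -> d w u <= (L + 1) * r n -> d w v <= (L + 1) * r n ->
  (forall y, y \in xs n -> d w y <= 4 * L * r n -> flat n y) ->
  p \in xs n -> d u p <= r n -> q \in xs n -> d v q <= r n ->
  enclosed n u v \/ near_end n u v.
Proof.
move=> c ws us vs uv e wu wv fl ps up qs vq.
have [h|h|[hp hq]] := parents_step c ws us vs uv e wu wv fl ps up qs vq.
- by left.
- by right.
have uv' : - pi v < - pi u by rewrite ltrN2.
  have hp' : - pi p <= - pi v by rewrite lerN2.
  have hq' : - pi q <= - pi v by rewrite lerN2.
  rewrite edgeC in e.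
  have [h|h] := parents_left (chartN c) ws vs us uv' e wv wu fl qs vq hq' ps up hp'.
    by left; exact: enclosedC.
  by right; exact: near_endC.
Qed.

(** Away from the coarse points that are not flat, a fine edge can be examined in the
chart of the parent of one of its ends. *)
Lemma edge_cases n u v : u \in xs n.+1 -> v \in xs n.+1 -> edge n.+1 (u, v) ->
  [\/ exists y, [/\ y \in xs n, ~~ flat n y & d u y <= 5 * L * r n],
     enclosed n u v | near_end n u v].
Proof.
move=> us vs uv_edge; have r0 := r_gt0 n; have lr := Lr n.
have [/hasP[y ys /andP[ny uy]]|hN] :=
    boolP (has (fun y => ~~ flat n y && (d u y <= 5 * L * r n)) (xs n)).
  by apply: Or31; exists y.
have [p ps up] := xs_cov us; have [q qs vq] := xs_cov vs.
have flatP y : y \in xs n -> d p y <= 4 * L * r n -> flat n y.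
  move=> ys py; move/hasPn: hN => /(_ y ys).
  rewrite negb_and negbK => /orP[//|/negP[]]; have := dT p u y; lra.
have [_] := edge_rng uv_edge; rewrite rS /= => duv.
have dpu : d p u <= (L + 1) * r n by rewrite dC; lra.
have dpv : d p v <= (L + 1) * r n by have := dT u p v; rewrite (dC p u); lra.
have fp : flat n p by apply: flatP => //; rewrite d0; lra.
have [pi c] := flat_chart ps fp.
have : enclosed n u v \/ near_end n u v; last by case; [apply: Or32|apply: Or33].
have nuv : u != v by have [/and4P[]] := edge_rng uv_edge.
have psS := xs_sub ps.
have inb z : z \in xs n.+1 -> d p z <= (L + 1) * r n ->
    (z \in xs n.+1) && (d p z <= A * r n).
  by move=> -> h /=; have := Ar n; lra.
have [le|lt] := leP (pi u) (pi v).
  have uv := chart_gap c (inb u us dpu) (inb v vs dpv) nuv le.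
  by apply: (edge_step c psS us vs _ uv_edge) ps up qs vq => //; lra.
rewrite edgeC in uv_edge.
have [h|h] := edge_step c psS vs us lt uv_edge dpv dpu flatP qs vq ps up.
  by left; exact: enclosedC.
by right; exact: near_endC.
Qed.


(** The ends of the finer graph among the children of a coarse point [w], on the right
side of a chart. *)
Section EndStep.
Context (n : nat) (w : V) (pi : V -> R).
Hypothesis chart_pi : chart d (xs n.+1) w (A * r n) (r n / 8) pi.

Let inb p := (p \in xs n.+1) && (d w p <= A * r n).

Let inbP p : p \in xs n.+1 -> d w p <= 5 * L * r n -> inb p.
Proof.
by move=> ps h; rewrite /inb ps /=; have := Ar n; have := Lr n; have := r_gt0 n; lra.
Qed.

Definition open_right m u := ~~ has (fun v => pi u < pi v) (nbrs m u).

(** Two children of [w] are within [2 * r n] of each other, so the one on the left has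
the other one as a neighbour to its right. *)
Lemma open_right_inj u u' : u \in xs n.+1 -> u' \in xs n.+1 ->
  d u w <= r n -> d u' w <= r n -> open_right n.+1 u -> open_right n.+1 u' -> u = u'.
Proof.
move=> us us' uw uw' h h'; apply/eqP; apply: contraT => uu'.
have r0 := r_gt0 n; have lr := Lr n.
have duu' : d u u' < L * r n.+1.
  by rewrite rS; have := dT w u u'; rewrite (dC w u'); lra.
have iu : inb u by apply: inbP => //; rewrite dC; lra.
have iu' : inb u' by apply: inbP => //; rewrite dC; lra.
have [le|lt] := leP (pi u) (pi u').
  have := chart_gap chart_pi iu iu' uu' le => lt.
  move/hasPn: h => /(_ u'); rewrite mem_filter eq_sym uu' duu' us' => /(_ isT).
  by rewrite (lt_trans _ lt)// ltrDl; lra.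
move/hasPn: h' => /(_ u); rewrite mem_filter uu' dC duu' us => /(_ isT).
by rewrite lt.
Qed.

Hypothesis ws : w \in xs n.

(** If [w] has a neighbour [v] to its right, the next fine point [x] after [u] comes no
later than [v]. As [u] is open, [x] is at distance at least [L * r n.+1], and it is
less than twice as far because [(w, v)] is short; so [(u, x)] is a long edge. It is
not parallel to an older bridge: that bridge would start at [w], and [v] would be
in its lune. *)
Lemma open_right_step u : u \in xs n.+1 -> d u w <= r n ->
  (forall y, y \in xs n.+1 -> d u y <= 5 * L * r n -> flat n.+1 y) ->
  open_right n.+1 u ->
  open_right n w \/ exists v, (u, v) \in bridges n.+1 /\ pi u < pi v.
Proof.
move=> us uw fl Ru; have r0 := r_gt0 n; have lr := Lr n.
have Ru' z : z \in xs n.+1 -> pi u < pi z -> L * r n.+1 <= d u z.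
  move=> zs uz; rewrite leNgt; apply/negP => duz; move/hasPn: Ru => /(_ z).
  rewrite mem_filter duz zs !andbT => /(_ _)/negP[] //.
  by apply: contraTneq uz => ->; rewrite ltxx.
have [|/negPn/hasP[v + wv]] := boolP (open_right n w); [by left|].
rewrite mem_filter => /andP[/andP[nvw dwv] vs]; right.
have wu : d w u <= r n by rewrite dC.
have iu : inb u by apply: inbP => //; lra.
have iw : inb w by apply: inbP; rewrite ?xs_sub// d0; lra.
have iv : inb v by apply: inbP; rewrite ?xs_sub//; lra.
have coarse_u : u \in xs n -> u = w.
  move=> un; apply/eqP; apply: contraT => nuw.
  by have := xs_sep un ws nuw; lra.
have nwv : w != v by rewrite eq_sym.
have gwv := chart_gap_coarse chart_pi iw iv ws vs nwv (ltW wv).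
(* a child of [w] cannot come after a point that is a full coarse gap beyond [w] *)
have far z : inb z -> z != u -> pi w + 7 / 8 * r n < pi z -> pi u < pi z.
  move=> iz nzu wz; rewrite ltNge; apply/negP => zu.
  have := chart_gap chart_pi iz iu nzu zu.
  by have /andP[] := chart_le chart_pi iw iu ltac:(lra); lra.
have uv : pi u < pi v.
  apply: far => //; apply: contraTneq vs => vu; apply/negP => vs.
  by rewrite vu in vs nvw; rewrite (coarse_u vs) eqxx in nvw.
have [|x [xsS /andP[ux wx] xmin]] := @seq_argmax R _ (xs n.+1) (fun z => - pi z)
    (fun z => (pi u < pi z) && (d w z <= 2 * L * r n)).
  by apply/hasP; exists v; rewrite ?xs_sub// uv /=; lra.
have xv : pi x <= pi v.
  by rewrite -lerN2; apply: xmin; rewrite ?xs_sub// uv /=; lra.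
have ix : inb x by apply: inbP => //; lra.
have dux := Ru' x xsS ux; rewrite rS in dux.
have wleu : pi w <= pi u.
  rewrite leNgt; apply/negP => uw'; have := Ru' w (xs_sub ws) uw'.
  by rewrite rS; lra.
have /andP[ux1 ux2] := chart_le chart_pi iu ix (ltW ux).
have /andP[wv1 wv2] := chart_le chart_pi iw iv (ltW wv).
have dux2 : d u x < L * r n.
  have [uw'|nuw] := eqVneq u w.
    have [xv'|nxv] := eqVneq x v; first by rewrite uw' xv'.
    by have := chart_gap chart_pi ix iv nxv xv; rewrite uw' in ux2 *; lra.
  have nwu : w != u by rewrite eq_sym.
  by have := chart_gap chart_pi iw iu nwu wleu; lra.
exists x; split=> //; rewrite mem_filter mem_pairs us xsS /= andbT.
apply/andP; split.
  apply/and3P; split; rewrite /= ?rS; [|lra|lra].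
  apply/and4P; split=> /=.
  - by apply: contraTneq ux => ->; rewrite ltxx.
  - by apply: fl => //; rewrite d0; lra.
  - by apply: fl => //; lra.
  - apply/allP => z zs /=; rewrite !leNgt -negb_and; apply/negP => /andP[uz zx].
    have wz : d w z <= 2 * L * r n by have := dT u w z; lra.
    have iz : inb z by apply: inbP => //; lra.
    have [h1 h2] := chart_lune chart_pi iu ix iz ux uz zx.
    by have := xmin z zs; rewrite h1 wz => /(_ isT); lra.
apply/hasPn => -[a b] /mem_bridges[]; rewrite mem_pairs => /andP[/= As bs].
move=> /and3P[/and4P[_ _ _ /allP /= lune] dab _]; rewrite /parallel /=.
apply/negP => /andP[ua xb].
have ia : inb a by apply: inbP; rewrite ?xs_sub//; have := dT u w a; lra.
have ib : inb b by apply: inbP; rewrite ?xs_sub//; have := dT x w b; lra.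
have [] := chart_pi (xs_sub As) us; rewrite ?(andP ia).2 ?(andP iu).2// ler_norml.
rewrite (dC a u) => /andP[ua1 ua2] _.
have [] := chart_pi (xs_sub bs) xsS; rewrite ?(andP ib).2 ?(andP ix).2// ler_norml.
rewrite (dC b x) => /andP[xb1 xb2] _.
have ab : pi a < pi b by lra.
have not_between z : z \in xs n -> inb z -> pi a < pi z -> pi z < pi b -> False.
  move=> zs iz az zb; have [h1 h2] := lune_chart chart_pi ia ib iz az zb.
  by have := lune z zs; rewrite !leNgt h1 h2.
have wa : pi w <= pi a.
  by rewrite leNgt; apply/negP => aw; apply: (not_between w) => //; lra.
have aw : a = w.
  apply/eqP; apply: contraT => naw; have nwa : w != a by rewrite eq_sym.
  have gwa := chart_gap_coarse chart_pi iw ia ws As nwa wa.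
  have nau : a != u.
    by apply: contraTneq As => au; apply/negP => /[!au]/coarse_u uw';
      rewrite au uw' eqxx in naw.
  by have := Ru' a (xs_sub As) (far a ia nau gwa); rewrite rS; lra.
rewrite aw in dab ab not_between.
apply: (not_between v) => //; rewrite ltNge; apply/negP => bv.
have /andP[wb1 wb2] := chart_le chart_pi iw ib (ltW ab).
have [bv'|nbv] := eqVneq b v; first by rewrite bv' in dab; lra.
by have := chart_gap_coarse chart_pi ib iv bs vs nbv bv; lra.
Qed.

End EndStep.


(** * Counting and charging to non-flat points *)

Lemma count_near m x t (s : seq V) (P : pred V) : x \in xs m -> flat m x ->
  0 <= t -> t <= A -> uniq s -> {subset s <= xs m.+1} ->
  (forall p, p \in s -> P p -> d x p <= t * r m) ->
  (count P s)%:R <= 6 * t + 1.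
Proof.
move=> xm fx t0 tA us ss sP; have r0 := r_gt0 m.
have [pi c] := flat_chart xm fx.
have tr : t * r m <= A * r m by rewrite ler_wpM2r// ltW.
have tr0 : 0 <= t * r m by rewrite mulr_ge0// ltW.
have Ar0 : d x x <= A * r m by rewrite d0 (le_trans _ tr).
have near p : p \in s -> P p -> (p \in xs m.+1) && (d x p <= A * r m).
  by move=> ps Pp; rewrite ss//=; apply: le_trans (sP p ps Pp) tr.
have h := @count_separated R V s P pi (pi x) (t * r m) (3 / 8 * r m) us _ tr0 _ _.
have := h ltac:(lra) _ _ => {}h.
have {h} : (count P s)%:R <= 2 * (t * r m) / (3 / 8 * r m) + 1.
  apply: h => [p ps Pp|p q ps qs Pp Pq npq].
    have [h1 _] := c p x (ss p ps) (xs_sub xm) (andP (near p ps Pp)).2 Ar0.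
    by apply: le_trans h1 _; rewrite dC; exact: sP.
  have [le|lt] := leP (pi p) (pi q).
    have := chart_gap c (near p ps Pp) (near q qs Pq) npq le.
    by rewrite distrC ger0_norm; lra.
  rewrite eq_sym in npq.
  have := chart_gap c (near q qs Pq) (near p ps Pp) npq (ltW lt).
  by rewrite ger0_norm; lra.
move/le_trans; apply; rewrite lerD2r ler_pdivrMr; last lra.
have -> : 6 * t * (3 / 8 * r m) = 9 / 4 * (t * r m) by lra.
lra.
Qed.

Lemma count_pairs (T : eqType) (s : seq T) (P : pred (T * T)) (Q : pred T) :
  (forall e, e \in pairs s -> P e -> Q e.1 && Q e.2) ->
  (count P (pairs s) <= count Q s * count Q s)%N.
Proof.
move=> PQ; rewrite -!size_filter.
have -> : (size [seq x <- s | Q x] * size [seq x <- s | Q x])%N =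
    size (pairs [seq x <- s | Q x]) by rewrite size_allpairs.
rewrite size_filter; apply: (@leq_trans (count (fun e => Q e.1 && Q e.2) (pairs s))).
  rewrite -!size_filter -(eq_in_filter (a1 := predI P (fun e => Q e.1 && Q e.2))).
    by rewrite filter_predI !size_filter count_filter sub_count// => e /= /andP[].
  by move=> e es /=; case Pe: (P e) => //=; rewrite PQ.
suff: forall s1, (count (fun e => Q e.1 && Q e.2) [seq (x, y) | x <- s1, y <- s] <=
    size [seq (x, y) | x <- [seq x <- s1 | Q x], y <- [seq x <- s | Q x]])%N by apply.
elim=> //= x t IH; rewrite count_cat count_map.
case: ifP => Qx /=; last first.
  by rewrite (eq_count (a2 := pred0)) ?count_pred0 ?add0n// => y /=; rewrite Qx.
rewrite size_cat size_map leq_add// size_filter.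
by rewrite sub_count// => y /= /andP[].
Qed.


(** The chart is provided by any of the flat points counted here, so a point [y] that is
not flat can pay for the flat points around it. *)
Lemma count_flat_near m y rho t : 0 <= t -> t <= A -> 2 * rho <= t * r m ->
  (count (fun u => flat m u && (d u y <= rho)) (xs m))%:R <= 6 * t + 1.
Proof.
move=> t0 tA rt; set P := fun u => _.
have [/hasP[x xm /andP[fx xy]]|] := boolP (has P (xs m)); last first.
  by rewrite has_count lt0n negbK => /eqP->; lra.
apply: (count_near xm fx t0 tA (xs_uniq m) (@xs_sub m)) => //.
by move=> p _ /andP[_ py]; have := dT y x p; rewrite (dC y p); lra.
Qed.

Lemma count_pairs_near m x t s (P : pred (V * V)) : x \in xs m -> flat m x ->
  0 <= t -> t <= A -> uniq s -> {subset s <= xs m.+1} ->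
  (forall e, e \in pairs s -> P e -> d x e.1 <= t * r m /\ d x e.2 <= t * r m) ->
  (count P (pairs s))%:R <= (6 * t + 1) ^+ 2.
Proof.
move=> xm fx t0 tA us ss near; pose Q p := d x p <= t * r m.
have cQ : (count Q s)%:R <= 6 * t + 1 by apply: (count_near xm fx t0 tA us ss).
apply: (@le_trans _ _ ((count Q s)%:R ^+ 2)); last first.
  by rewrite lerXn2r// nnegrE ?ler0n//; lra.
rewrite -natrX ler_nat -mulnn; apply: count_pairs => e es Pe.
by have [] := near e es Pe; rewrite /Q => -> ->.
Qed.

Definition nonflat n : R := (count (fun x => ~~ flat n x) (xs n))%:R.

(** The total excess length that flat points allow at scale [n], up to a factor; it
also pays for the points that are not flat, by [nonflat_defect]. *)
Definition defect n : R := \sum_(x <- xs n) eta n x * r n.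

Lemma defect_ge0 n : 0 <= defect n.
Proof. by apply: sumr_ge0 => x _; rewrite mulr_ge0// ltW. Qed.

Lemma nonflat_ge0 n : 0 <= nonflat n.
Proof. exact: ler0n. Qed.

Lemma nonflat_defect n : nonflat n * r n <= 8 * defect n.
Proof.
have r0 := r_gt0 n; rewrite /nonflat -sum1_countR /defect mulr_suml mulr_sumr.
rewrite big_mkcond; apply: ler_sum => x _; case: ifPn => [|_]; last first.
  by rewrite mulr_ge0// mulr_ge0// ltW.
by rewrite /flat -leNgt => ef; rewrite mulrA ler_wpM2r ?(ltW r0)//; lra.
Qed.

Section Chain.
Context (n : nat) (a b : V).
Hypotheses (As : a \in xs n) (bs : b \in xs n) (ab_edge : short_edge n (a, b)).

Let inside e := edge n.+1 e && between (a, b) e.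

(** In the chart the fine edges inside [(a, b)] are intervals with disjoint interiors,
each of them longer than its projection by at most [e * r n]. *)
Let chain_chart e pi : chart d (xs n.+1) a (A * r n) (r n / 8) pi ->
  chart d (xs n.+1) a (A * r n) (e * r n) pi -> 0 <= e -> pi a < pi b ->
  \sum_(x <- pairs (xs n.+1) | inside x) d x.1 x.2 <=
    d a b + (6 * L + 1) ^+ 2 * (e * r n).
Proof.
move=> c ce e0 ab; have r0 := r_gt0 n; have lr := Lr n; have ar := Ar n.
have /andP[/and4P[_ fa _ _] /= dab] := ab_edge.
have er0 : 0 <= e * r n by rewrite mulr_ge0// ltW.
pose inb p := (p \in xs n.+1) && (d a p <= A * r n).
have ia : inb a by rewrite /inb xs_sub// d0; lra.
have ib : inb b by rewrite /inb xs_sub//=; lra.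
have /andP[ab1 ab2] := chart_le c ia ib (ltW ab).
have key x : x \in pairs (xs n.+1) -> inside x ->
    [/\ inb x.1, inb x.2, pi a <= pi x.1, pi x.1 < pi x.2 & pi x.2 <= pi b].
  case: x => u v; rewrite mem_pairs => /andP[/= us vs].
  move=> /andP[/edge_rng[/and4P[nuv _ _ _] _]].
  move=> /and5P[/= au ub av vb /andP[auv uvb]].
  have iu : inb u by rewrite /inb us /=; lra.
  have iv : inb v by rewrite /inb vs /=; lra.
  have in_ab p : inb p -> d a p <= d a b -> d p b <= d a b ->
      pi a <= pi p /\ pi p <= pi b.
    move=> ip ap pb; split; rewrite leNgt; apply/negP => h.
      have npa : p != a by apply: contraTneq h => ->; rewrite ltxx.
      have := chart_gap c ip ia npa (ltW h).
      by have /andP[] := chart_le c ip ib ltac:(lra); lra.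
    have nbp : b != p by apply: contraTneq h => ->; rewrite ltxx.
    have := chart_gap c ib ip nbp (ltW h).
    by have /andP[] := chart_le c ia ip ltac:(lra); lra.
  have [u1 u2] := in_ab u iu au ub; have [v1 v2] := in_ab v iv av vb.
  split=> //; rewrite ltNge; apply/negP => vu; rewrite eq_sym in nuv.
  have := chart_gap c iv iu nuv vu.
  have /andP[_ h1] := chart_le c ia iv v1; have /andP[h2 _] := chart_le c ia iu u1.
  lra.
apply: (@le_trans _ _ (\sum_(x <- pairs (xs n.+1) | inside x)
    ((pi x.2 - pi x.1) + e * r n))).
  rewrite big_seq_cond [leRHS]big_seq_cond; apply: ler_sum => x /andP[xp xi].
  have [/andP[s1 n1] /andP[s2 n2] _ lt _] := key x xp xi.
  by have [_] := ce x.1 x.2 s1 s2 n1 n2; rewrite distrC gtr0_norm; lra.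
rewrite big_split /= lerD//; last first.
  apply: sum_le_count => //.
  apply: (count_pairs_near As fa) => //.
  - by have := HL; lra.
  - by have := HL; have := HA; lra.
  - by move=> x xp xi; move: (xi) => /andP[_ /and5P[/= h1 _ h2 _ _]]; split; lra.
apply: le_trans ab1; rewrite -big_filter; apply: sum_disjoint_intervals.
- exact: ltW.
- exact/filter_uniq/uniq_pairs.
- by move=> x; rewrite mem_filter => /andP[xi xp]; have [_ _] := key x xp xi.
move=> x y; rewrite !mem_filter => /andP[xi xp] /andP[yi yp] nxy.
have lune z t : z \in pairs (xs n.+1) -> inside z -> inb t ->
    pi z.1 < pi t -> pi t < pi z.2 -> False.
  move=> zp zi it h1 h2; have [i1 i2 _ _ _] := key z zp zi.
  have [k1 k2] := lune_chart c i1 i2 it h1 h2.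
  move: zi it => /andP[/edge_rng[/and4P[_ _ _ /allP h] _] _] /andP[ts _].
  by have := h t ts; rewrite !leNgt k1 k2.
have [x1 x2 _ lx _] := key x xp xi; have [y1 y2 _ ly _] := key y yp yi.
have [h|h] := leP (pi x.2) (pi y.1); first by left.
have [h'|h'] := leP (pi y.2) (pi x.1); first by right.
have chart_inj p q : inb p -> inb q -> pi p = pi q -> p = q.
  move=> ip iq pq; apply/eqP; apply: contraT => npq.
  by have := chart_gap c ip iq npq ltac:(lra); lra.
exfalso; have [lt|gt|E1] := ltgtP (pi x.1) (pi y.1).
- exact: (lune x y.1).
- exact: (lune y x.1).
have [lt|gt|E2] := ltgtP (pi x.2) (pi y.2).
- by apply: (lune y x.2) => //; lra.
- by apply: (lune x y.2) => //; lra.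
case/eqP: nxy; rewrite (surjective_pairing x) (surjective_pairing y).
by rewrite (chart_inj _ _ x1 y1 E1) (chart_inj _ _ x2 y2 E2).
Qed.

(** The error of the charts can be taken arbitrarily close to [eta n a]. *)
Lemma chain_sum : \sum_(x <- pairs (xs n.+1) | inside x) d x.1 x.2 <=
  d a b + (6 * L + 1) ^+ 2 * (eta n a * r n).
Proof.
have r0 := r_gt0 n; have lr := Lr n; have ar := Ar n.
have /andP[/and4P[nab fa _ _] /= dab] := ab_edge.
set S := \sum_(x <- _ | _) _; set N := (6 * L + 1) ^+ 2.
have N0 : 0 <= N by rewrite sqr_ge0.
have step e : eta n a < e -> e < 1 / 8 -> S <= d a b + N * (e * r n).
  move=> ae e16; have [pi ce] := charts As ae.
  have e0 : 0 <= e by apply: le_trans (ltW ae); exact: eta_ge0.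
  have c : chart d (xs n.+1) a (A * r n) (r n / 8) pi.
    move=> p q ps qs wp wq; have [h1 h2] := ce p q ps qs wp wq; split=> //.
    apply: le_trans h2 _; rewrite lerD2l.
    by apply: (@le_trans _ _ (1 / 8 * r n)); [rewrite ler_wpM2r// ltW|lra].
  have ia : (a \in xs n.+1) && (d a a <= A * r n) by rewrite xs_sub// d0; lra.
  have ib : (b \in xs n.+1) && (d a b <= A * r n) by rewrite xs_sub//=; lra.
  have [le|lt] := leP (pi a) (pi b).
    apply: (chain_chart c ce e0); have := chart_gap c ia ib nab le; lra.
  by apply: (chain_chart (chartN c) (chartN ce) e0); rewrite ltrN2.
apply/ler_addgt0Pr => z z0.
have M0 : 0 < N * r n + 1 by rewrite ltr_wpDl// mulr_ge0// ltW.
pose m := Num.min ((1 / 8 - eta n a) / 2) (z / (N * r n + 1)).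
have m0 : 0 < m by rewrite lt_min divr_gt0 ?divr_gt0// subr_gt0.
have m1 : m <= (1 / 8 - eta n a) / 2 by rewrite ge_min lexx.
have m2 : m * (N * r n + 1) <= z by rewrite -ler_pdivlMr// ge_min lexx orbT.
have faP : eta n a < 1 / 8 := fa.
have := step (eta n a + m) ltac:(lra) ltac:(lra).
have -> : N * ((eta n a + m) * r n) = N * (eta n a * r n) + (m * (N * r n + 1) - m) by lra.
lra.
Qed.

End Chain.


Definition parent n u := nth u (xs n) (find (fun w => d u w <= r n) (xs n)).

Lemma parentP n u : u \in xs n.+1 -> parent n u \in xs n /\ d u (parent n u) <= r n.
Proof.
move=> /xs_cov[x xn ux].
have hx : has (fun w => d u w <= r n) (xs n) by apply/hasP; exists x.
by split; [rewrite mem_nth// -has_find|exact: (nth_find u hx)].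
Qed.

(** * The length recursion *)

Definition flength n := \sum_(e <- pairs (xs n) | short_edge n e) d e.1 e.2.

Definition blength n := \sum_(e <- bridges n) d e.1 e.2.

Definition nends n : R := \sum_(u <- xs n | flat n u) (ends n u)%:R.

Lemma edges_sum n : \sum_(e <- pairs (xs n) | edge n e) d e.1 e.2 = flength n + blength n.
Proof.
rewrite (bigID (short_edge n)) /=; congr (_ + _).
  by apply: eq_bigl => e; rewrite /edge; case: (short_edge _ _); rewrite ?andbF.
rewrite /blength; case: n => [|n].
  rewrite big_nil big1// => e /andP[]; rewrite /edge in_nil orbF.
  by move=> ->.
rewrite /= big_filter big_seq_cond [RHS]big_seq_cond.
apply: eq_bigl => e; case es: (e \in _) => //=.
rewrite /edge /= mem_filter es andbT /short_edge /long_edge.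
by case: (rng _ _) => //=; rewrite leNgt; case: (_ < L * _) => //=; rewrite andbT.
Qed.

Definition nonflat_edge_cost : R := (6 * (22 * L) + 1) ^+ 2 * L.

(** Bound, in units of [r n], for the total length of the fine edges within
[2 * r n] of an end. *)
Definition end_cost : R := (6 * 2 + 1) ^+ 2 * 4.

(** The edges of the finer graph are sorted by [edge_cases]. Those inside a coarse
short edge are bounded by [chain_sum]; near an end or near a point that is not
flat there is a bounded number of edges of length at most a multiple of [r n]. *)
Lemma flength_step n : flength n.+1 + blength n.+1 <=
  flength n + (6 * L + 1) ^+ 4 * defect n + end_cost * (r n * nends n) +
  nonflat_edge_cost * (nonflat n * r n).
Proof.
have r0 := r_gt0 n; have lr := Lr n; have ar := Ar n; have hL := HL; have hA := HA.
rewrite -edges_sum.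
pose P1 (e : V * V) := has (fun y => ~~ flat n y && (d e.1 y <= 5 * L * r n)) (xs n).
pose P2 e := has (fun g => short_edge n g && between g e) (pairs (xs n)).
pose P3 e := has (fun w => [&& flat n w, (0 < ends n w)%N, d e.1 w <= 2 * r n &
   d e.2 w <= 2 * r n]) (xs n).
have dpos (e : V * V) : 0 <= d e.1 e.2 by exact: d_ge0.
have split_cases : \sum_(e <- pairs (xs n.+1) | edge n.+1 e) d e.1 e.2 <=
    \sum_(e <- pairs (xs n.+1) | edge n.+1 e && P2 e) d e.1 e.2 +
    \sum_(e <- pairs (xs n.+1) | edge n.+1 e && P3 e) d e.1 e.2 +
    \sum_(e <- pairs (xs n.+1) | edge n.+1 e && P1 e) d e.1 e.2.
  rewrite !big_mkcondr -!big_split big_seq_cond [leRHS]big_seq_cond /=.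
  apply: ler_sum => -[u v] /andP[]; rewrite mem_pairs => /andP[/= us vs] uv.
  have := d_ge0 u v; case: (edge_cases us vs uv).
  - move=> [y [ys fy uy]].
    have -> : P1 (u, v) by apply/hasP; exists y; rewrite ?fy.
    by case: ifP; case: ifP; lra.
  - move=> [g [gs sg bg]].
    have -> : P2 (u, v) by apply/hasP; exists g; rewrite ?sg.
    by case: ifP; case: ifP; lra.
  - move=> [w [ws fw ew uw vw]].
    have -> : P3 (u, v) by apply/hasP; exists w; rewrite ?fw ?ew ?uw.
    by case: ifP; case: ifP; lra.
have N0 : 0 <= (6 * L + 1) ^+ 2 by rewrite sqr_ge0.
have along : \sum_(e <- pairs (xs n.+1) | edge n.+1 e && P2 e) d e.1 e.2 <=
    flength n + (6 * L + 1) ^+ 4 * defect n.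
  apply: (@le_trans _ _ (\sum_(g <- pairs (xs n) | short_edge n g)
      \sum_(e <- pairs (xs n.+1) | (edge n.+1 e && P2 e) && between g e) d e.1 e.2)).
    by apply: charge => // e _ /andP[_ /hasP[g gs /andP[sg bg]]]; exists g.
  apply: (@le_trans _ _ (\sum_(g <- pairs (xs n) | short_edge n g)
      (d g.1 g.2 + (6 * L + 1) ^+ 2 * (eta n g.1 * r n)))).
    rewrite big_seq_cond [leRHS]big_seq_cond; apply: ler_sum => -[a b].
    rewrite mem_pairs => /andP[/andP[/= As bs] ab].
    apply: le_trans (chain_sum As bs ab); apply: ler_sum_cond => // e _.
    by move=> /andP[/andP[-> _] ->].
  rewrite big_split /= lerD2l -mulr_sumr (exprM _ 2 2) [_ ^+ 2 ^+ 2]expr2 -mulrA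
    ler_wpM2l//.
  apply: (@le_trans _ _ (\sum_(a <- xs n | true)
      \sum_(g <- pairs (xs n) | short_edge n g && (g.1 == a)) eta n g.1 * r n)).
    apply: charge => [g|g]; first by rewrite mulr_ge0// ltW.
    by rewrite mem_pairs => /andP[g1 _] _; exists g.1.
  rewrite /defect mulr_sumr big_seq_cond [leRHS]big_seq_cond; apply: ler_sum => a.
  rewrite andbT => As; apply: sum_le_count; first by rewrite mulr_ge0// ltW.
    by move=> g _ /andP[_ /eqP->].
  set P := fun g => _; have [/hasP[g0 _]|] := boolP (has P (pairs (xs n))); last first.
    by rewrite has_count lt0n negbK => /eqP->.
  move=> /andP[/andP[/and4P[_ fa _ _] _] /eqP ga]; rewrite ga in fa.
  apply: (count_pairs_near As fa _ _ (xs_uniq n) (@xs_sub n)); [lra|lra|].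
  move=> g _ /andP[/andP[_ dg] /eqP <-]; split; last exact: ltW.
  by rewrite d0; lra.
have near_ends : \sum_(e <- pairs (xs n.+1) | edge n.+1 e && P3 e) d e.1 e.2 <=
    end_cost * (r n * nends n).
  pose Q w (e : V * V) := (d e.1 w <= 2 * r n) && (d e.2 w <= 2 * r n).
  apply: (@le_trans _ _ (\sum_(w <- xs n | flat n w && (0 < ends n w)%N)
      \sum_(e <- pairs (xs n.+1) | (edge n.+1 e && P3 e) && Q w e) d e.1 e.2)).
    apply: charge => // e _ /andP[_ /hasP[w ws /and4P[fw ew h1 h2]]]; exists w.
    by rewrite fw ew /Q h1 h2.
  have -> : end_cost * (r n * nends n) = \sum_(w <- xs n | flat n w) end_cost * (r n *
    (ends n w)%:R).
    by rewrite /nends !mulr_sumr.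
  rewrite big_mkcondr big_seq_cond [leRHS]big_seq_cond; apply: ler_sum => w /andP[ws fw].
  case: ifPn => [ew|_]; last first.
    by apply: mulr_ge0; [rewrite /end_cost mulr_ge0 ?sqr_ge0|rewrite mulr_ge0// ltW].
  have e1 : 1 <= (ends n w)%:R :> R by rewrite ler1n.
  apply: (@le_trans _ _ ((6 * 2 + 1) ^+ 2 * (4 * r n))).
    apply: sum_le_count; first by rewrite mulr_ge0// ltW.
      by move=> [u v] _ /andP[_ /andP[/= h1 h2]]; have := dT w u v; rewrite (dC w v); lra.
    apply: (count_pairs_near ws fw _ _ (xs_uniq n.+1) (fun=> id)); [lra|lra|].
    by move=> [u v] _ /andP[_ /andP[/= h1 h2]]; rewrite (dC w u) (dC w v).
  have : r n <= r n * (ends n w)%:R by rewrite ler_peMr// ltW.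
  by rewrite /end_cost; set x := r n * _; lra.
(* one of the edges counted provides the flat point whose chart bounds their number *)
have near_nonflat : \sum_(e <- pairs (xs n.+1) | edge n.+1 e && P1 e) d e.1 e.2 <=
    nonflat_edge_cost * (nonflat n * r n).
  apply: (@le_trans _ _ (\sum_(y <- xs n | ~~ flat n y)
      \sum_(e <- pairs (xs n.+1) | (edge n.+1 e && P1 e) && (d e.1 y <= 5 * L * r n))
        d e.1 e.2)).
    by apply: charge => // e _ /andP[_ /hasP[y ys /andP[fy h]]]; exists y.
  have -> : nonflat_edge_cost * (nonflat n * r n) = \sum_(y <- xs n | ~~ flat n y)
      (6 * (22 * L) + 1) ^+ 2 * (L * r n).
    rewrite big_const_seq iter_addr_0 -[RHS]mulr_natl /nonflat_edge_cost /nonflat.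
    by set c := _%:R; ring.
  apply: ler_sum => y _; apply: sum_le_count; first by rewrite mulr_ge0 ?(ltW r0)//; lra.
    move=> e _ /andP[/andP[/edge_rng[_ h] _] _]; apply: ltW.
    by move: h; rewrite rS; lra.
  set P := fun e => _; have [/hasP[e0]|] := boolP (has P (pairs (xs n.+1))); last first.
    by rewrite has_count lt0n negbK => /eqP->; rewrite sqr_ge0.
  rewrite mem_pairs => /andP[us _] /andP[/andP[/edge_rng[/and4P[_ fu _ _] _] _] uy].
  apply: (count_pairs_near us fu _ _ (xs_uniq n.+1) (@xs_sub n.+1)); [lra|lra|].
  move=> e _ /andP[/andP[/edge_rng[_ de] _] ey]; rewrite rS in de *.
  have := dT y e0.1 e.1; rewrite (dC y e.1); have := dT e.1 e0.1 e.2.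
  by split; lra.
by lra.
Qed.


Lemma count_le1 (T : eqType) (s : seq T) (P : pred T) : uniq s ->
  (forall x y, x \in s -> y \in s -> P x -> P y -> x = y) -> (count P s <= 1)%N.
Proof.
move=> us inj; rewrite -size_filter leqNgt; apply/negP.
case E: [seq x <- s | P x] => [|x [|y t]]//= _.
have := filter_uniq P us; rewrite E /= inE negb_or => /andP[/andP[/eqP xy _] _].
have h z : z \in [seq x <- s | P x] -> (z \in s) /\ P z by rewrite mem_filter => /andP[].
have [] := h x; first by rewrite E mem_head.
have [] := h y; first by rewrite E !inE eqxx orbT.
by move=> ys Py xs' Px; apply: xy; apply: inj.
Qed.

Lemma ends_le2 n u : (ends n u <= 2)%N.
Proof. by rewrite /ends; case: (nbrs _ _) => // x t; case: (has _ _). Qed.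

Lemma ends_open n m w pi u : chart d (xs n.+1) w (A * r n) (r n / 8) pi ->
  u \in xs m -> {subset xs m <= xs n.+1} -> r m <= r n -> d w u <= r n ->
  ends m u = (open_right pi m u + open_right (fun x => (- pi x)%R) m u)%N.
Proof.
move=> c um ms mn wu; have lr := Lr n; have ar := Ar n; have r0 := r_gt0 n.
have lm : L * r m <= L * r n by rewrite ler_wpM2l//; have := HL; lra.
rewrite (chart_ends c); first last.
- move=> v; rewrite mem_filter => /andP[/andP[_ uv] vm]; rewrite ms//=.
  by have := dT u w v; lra.
- by rewrite ms//=; lra.
by congr (_ + ~~ _)%N; apply: eq_has => v; rewrite ltrN2.
Qed.

Definition nonflat_end_cost : R := 2 * (6 * (20 * L) + 1).

(** Unless a point that is not flat is near, the ends of the finer graph are counted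
by their parents: on each side of [w] there is at most one, and it is accounted
for by an end at [w] or by a new bridge. *)
Lemma nends_step n : nends n.+1 <= nends n + (size (bridges n.+1))%:R +
  nonflat_end_cost * (nonflat n + nonflat n.+1).
Proof.
have r0 := r_gt0 n; have lr := Lr n; have hL := HL; have hA := HA.
pose bad1 u := ~~ flat n (parent n u).
pose bad2 u := has (fun y => ~~ flat n.+1 y && (d u y <= 5 * L * r n)) (xs n.+1).
have e0 u : 0 <= (ends n.+1 u)%:R :> R by exact: ler0n.
have e2 u : (ends n.+1 u)%:R <= 2 :> R by rewrite ler_nat ends_le2.
have split3 : nends n.+1 <=
    \sum_(u <- xs n.+1 | flat n.+1 u && (~~ bad1 u && ~~ bad2 u)) (ends n.+1 u)%:R +
    \sum_(u <- xs n.+1 | flat n.+1 u && bad1 u) (ends n.+1 u)%:R +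
    \sum_(u <- xs n.+1 | flat n.+1 u && bad2 u) (ends n.+1 u)%:R.
  rewrite /nends !big_mkcondr -!big_split /=; apply: ler_sum => u _.
  by have := e0 u; case: (bad1 u); case: (bad2 u) => /=; lra.
have charged (t : seq V) (B : pred V) (rho k : R) (P : pred V) :
    (forall u, u \in xs n.+1 -> P u -> exists y, [/\ y \in t, B y & d u y <= rho]) ->
    0 <= k -> k <= 20 * L -> 2 * rho <= k * r n.+1 ->
    \sum_(u <- xs n.+1 | flat n.+1 u && P u) (ends n.+1 u)%:R <=
      nonflat_end_cost * (count B t)%:R.
  move=> Pt k0 kL kr.
  apply: (@le_trans _ _ (\sum_(y <- t | B y)
     \sum_(u <- xs n.+1 | (flat n.+1 u && P u) && (d u y <= rho)) (ends n.+1 u)%:R)).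
    by apply: charge => // u us /andP[_ Pu]; apply: Pt.
  have -> : nonflat_end_cost * (count B t)%:R = \sum_(y <- t | B y) (6 * (20 * L) + 1) * 2.
    by rewrite big_const_seq iter_addr_0 -[RHS]mulr_natl /nonflat_end_cost; set c :=
      _%:R; ring.
  apply: ler_sum => y _; apply: sum_le_count => //.
  have h := @count_flat_near n.+1 y rho k k0 ltac:(lra) kr.
  apply: (@le_trans _ _ (6 * k + 1)); last lra.
  apply: le_trans h; rewrite ler_nat; apply: sub_count => u /=.
  by move=> /andP[/andP[-> _] ->].
have near1 : \sum_(u <- xs n.+1 | flat n.+1 u && bad1 u) (ends n.+1 u)%:R <=
  nonflat_end_cost * nonflat n.
  apply: (charged (xs n) (fun y => ~~ flat n y) (r n) 4); rewrite ?rS; [|lra|lra|lra].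
  move=> u us fu; exists (parent n u); have [h1 h2] := parentP us.
  by split.
have near2 : \sum_(u <- xs n.+1 | flat n.+1 u && bad2 u) (ends n.+1 u)%:R <=
  nonflat_end_cost * nonflat n.+1.
  apply: (charged (xs n.+1) (fun y => ~~ flat n.+1 y) (5 * L * r n) (20 * L));
    rewrite ?rS; [|lra|lra|lra].
  by move=> u us /hasP[y ys /andP[fy uy]]; exists y.
pose T w u := (flat n.+1 u && (~~ bad1 u && ~~ bad2 u)) && (parent n u == w).
pose br w := count (fun e : V * V => parent n e.1 == w) (bridges n.+1).
have per_point w : w \in xs n ->
    \sum_(u <- xs n.+1 | T w u) (ends n.+1 u)%:R <= (ends n w)%:R + (br w)%:R :> R.
  move=> ws; have [/hasP[u1 us1 /andP[/andP[_ /andP[b1 _]] /eqP pu1]]|] :=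
      boolP (has (T w) (xs n.+1)); last first.
    rewrite -all_predC => /allP h; rewrite big_seq_cond big1 ?addr_ge0 ?ler0n//.
    by move=> u /andP[us Tu]; have /negP[] := h u us.
  have fw : flat n w by move: b1; rewrite /bad1 pu1 negbK.
  have [pi c] := flat_chart ws fw; rewrite -natr_sum -natrD ler_nat.
  have inT u : u \in xs n.+1 -> T w u -> d u w <= r n /\
      (forall y, y \in xs n.+1 -> d u y <= 5 * L * r n -> flat n.+1 y).
    move=> us /andP[/andP[_ /andP[_ /hasPn nb]] /eqP pw].
    split; first by have [_] := parentP us; rewrite pw.
    by move=> y ys uy; have := nb y ys; rewrite uy andbT negbK.
  have side si : chart d (xs n.+1) w (A * r n) (r n / 8) si ->
      (count (fun u => T w u && open_right si n.+1 u) (xs n.+1) <= open_right si n w +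
      count (fun e : V * V => (parent n e.1 == w) && (si e.1 < si e.2)%R) (bridges n.+1))%N.
    move=> cs; set P := fun u => _; have [|] := boolP (has P (xs n.+1)); last first.
      by rewrite has_count lt0n negbK => /eqP->.
    move=> /hasP[u us /andP[Tu Ru]]; apply: (@leq_trans 1%N).
      apply: count_le1 => // x y xS yS /andP[Tx Rx] /andP[Ty Ry].
      by apply: (open_right_inj cs) Rx Ry => //; [have [] := inT x xS Tx|have [] :=
        inT y yS Ty].
    have [duw fl] := inT u us Tu.
    have [->|[v [uv suv]]] := open_right_step cs ws us duw fl Ru.
      by rewrite leq_addr.
    apply: leq_trans (leq_addl _ _); rewrite -has_count; apply/hasP.
    by exists (u, v) => //=; rewrite suv andbT; move: Tu => /andP[].
  have -> : (\sum_(u <- xs n.+1 | T w u) ends n.+1 u)%N =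
      (count (fun u => T w u && open_right pi n.+1 u) (xs n.+1) +
       count (fun u => T w u && open_right (fun x => - pi x)%R n.+1 u) (xs n.+1))%N.
    have cE (Q : pred V) : count (fun u => T w u && Q u) (xs n.+1) =
        (\sum_(u <- xs n.+1 | T w u) Q u)%N.
      rewrite -sum1_count [LHS](big_mkcondr _ _ (T w)).
      by apply: eq_bigr => u _; case: (Q u).
    rewrite !cE -big_split big_seq_cond [RHS]big_seq_cond.
    apply: eq_bigr => u /andP[us Tu]; have [duw _] := inT u us Tu.
    by rewrite (ends_open c us) //=; [rewrite rS; lra|rewrite dC].
  rewrite (ends_open c ws (@xs_sub n) (lexx _)) ?d0 ?(ltW r0)//.
  apply: leq_trans (leq_add (side pi c) (side _ (chartN c))) _.
  rewrite addnACA leq_add2l /br -count_predUI.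
  set a := count _ _; set b := count _ _; have -> : b = 0%N.
    apply/eqP; rewrite -leqn0 leqNgt -has_count; apply/hasPn => e _ /=.
    by rewrite ltrN2; apply/negP => /andP[/andP[_ h] /andP[_ h']]; lra.
  by rewrite addn0; apply: sub_count => e /= /orP[] /andP[].
have ok_part : \sum_(u <- xs n.+1 | flat n.+1 u && (~~ bad1 u &&
  ~~ bad2 u)) (ends n.+1 u)%:R
    <= nends n + (size (bridges n.+1))%:R.
  apply: (@le_trans _ _ (\sum_(w <- xs n | flat n w) ((ends n w)%:R + (br w)%:R))).
    apply: (@le_trans _ _ (\sum_(w <- xs n | flat n w) \sum_(u <- xs n.+1 | T w u)
        (ends n.+1 u)%:R)).
      apply: charge => // u us /andP[_ /andP[b1 _]]; exists (parent n u).
      have [h1 h2] := parentP us; split=> //.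
      by rewrite /bad1 negbK in b1.
    rewrite big_seq_cond [leRHS]big_seq_cond; apply: ler_sum => w /andP[ws _].
    exact: per_point.
  rewrite big_split /= lerD2l; apply: (@le_trans _ _ (\sum_(w <- xs n) (br w)%:R)).
    by apply: ler_sum_cond => // w; exact: ler0n.
  rewrite -natr_sum ler_nat /br; under eq_bigr do rewrite -sum1_count big_mkcond.
  rewrite exchange_big /= -sum1_size; apply: leq_sum => e _; rewrite -big_mkcond sum1_count.
  by apply: count_le1 => // x y _ _ /eqP<- /eqP<-.
rewrite mulrDr; lra.
Qed.


(** The ends created by a bridge cost a fixed multiple of [r n], whereas the bridge is
at least [L * r n] long. *)
Hypothesis HLbig : 4 * end_cost <= L.

Lemma blength_size n : (size (bridges n))%:R * (L * r n) <= blength n.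
Proof.
rewrite /blength -[size _]count_predT -sum1_countR mulr_suml.
rewrite big_seq_cond [leRHS]big_seq; under [leRHS]eq_bigl do rewrite -[_ \in _]andbT.
by apply: ler_sum => e /andP[/mem_bridges[_ /and3P[]]]; rewrite mul1r.
Qed.

(** The extensions of one end at all later scales cost at most a geometric series,
which is prepaid here. *)
Definition potential n := flength n + 2 * end_cost * (r n * nends n).

Definition defect_cost : R := (6 * L + 1) ^+ 4 + 8 * nonflat_edge_cost +
  16 * (end_cost * nonflat_end_cost).

Lemma defect_cost_ge0 : 0 <= defect_cost.
Proof.
have hL := HL; rewrite /defect_cost /nonflat_edge_cost /nonflat_end_cost /end_cost.
by rewrite !addr_ge0 ?mulr_ge0 ?exprn_ge0//; lra.
Qed.

(** Half the length of a new bridge pays for the ends that it creates. *)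
Lemma potential_step n : potential n.+1 + blength n.+1 / 2 <=
  potential n + defect_cost * (defect n + defect n.+1).
Proof.
have r0 := r_gt0 n; have hL := HL; have hE := HLbig.
have c0 : 0 <= end_cost by rewrite /end_cost; lra.
have f := flength_step n; have e := nends_step n; have b := blength_size n.+1.
have dn := nonflat_defect n; have dn' := nonflat_defect n.+1.
have q0 := nonflat_ge0 n; have q1 := nonflat_ge0 n.+1.
have p0 := defect_ge0 n; have p1 := defect_ge0 n.+1.
have k10 : 0 <= nonflat_edge_cost by rewrite /nonflat_edge_cost mulr_ge0 ?sqr_ge0//; lra.
have k20 : 0 <= end_cost * nonflat_end_cost by rewrite mulr_ge0// /nonflat_end_cost; lra.
have k40 : 0 <= (6 * L + 1) ^+ 4 by apply: exprn_ge0; lra.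
rewrite rS in b dn'.
have e1 : end_cost * r n * nends n.+1 <= end_cost * r n * (nends n +
   (size (bridges n.+1))%:R + nonflat_end_cost * (nonflat n + nonflat n.+1)).
  by rewrite ler_wpM2l// mulr_ge0// ltW.
have e2 : 4 * end_cost * ((size (bridges n.+1))%:R * r n) <=
    L * ((size (bridges n.+1))%:R * r n).
  by rewrite ler_wpM2r// mulr_ge0// ltW.
have e3 : nonflat_edge_cost * (nonflat n * r n) <=
  nonflat_edge_cost * (8 * defect n) by rewrite ler_wpM2l.
have e4 : end_cost * nonflat_end_cost * (nonflat n * r n) <=
  end_cost * nonflat_end_cost * (8 * defect n).
  by rewrite ler_wpM2l.
have e5 : end_cost * nonflat_end_cost * (nonflat n.+1 * (r n / 2)) <=
  end_cost * nonflat_end_cost * (8 * defect n.+1).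
  by rewrite ler_wpM2l.
have e6 := mulr_ge0 k40 p1; have e7 := mulr_ge0 k10 p1; have e8 := mulr_ge0 k20 p0.
rewrite /potential /defect_cost rS.
move: e1 e2 e3 e4 e5 e6 e7 e8 f b.
move: ((6 * L + 1) ^+ 4) nonflat_edge_cost nonflat_end_cost end_cost (nends n.+1)
  (nends n) (nonflat n) (nonflat n.+1)
  (flength n.+1) (flength n) (blength n.+1) (defect n) (defect n.+1) (_%:R) (r n) => *.
lra.
Qed.

Lemma potential_sum N : potential N + (\sum_(n < N.+1) blength n) / 2 <=
  4 * end_cost * r 0 + 2 * defect_cost * \sum_(n < N.+1) defect n.
Proof.
have k0 := defect_cost_ge0.
suff : potential N + (\sum_(n < N.+1) blength n) / 2 <=
    4 * end_cost * r 0 + 2 * defect_cost * \sum_(n < N.+1) defect n - defect_cost *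
      defect N.
  by have := mulr_ge0 k0 (defect_ge0 N); lra.
elim: N => [|N IH]; last first.
  rewrite big_ord_recr [in leRHS]big_ord_recr /= mulrDl mulrDr.
  by have := potential_step N; lra.
have c0 : 0 <= end_cost by rewrite /end_cost; lra.
have [x x0] := xs0; rewrite !big_ord1 /= {1}/blength /= big_nil mul0r addr0.
have -> : potential 0 = 2 * end_cost * (r 0 * nends 0).
  rewrite /potential /flength x0 /= big_cons big_nil /short_edge /rng eqxx /=.
  by rewrite add0r.
have : nends 0 <= 2.
  rewrite /nends x0 big_cons big_nil; case: ifP => _; last by lra.
  by rewrite addr0 ler_nat ends_le2.
move=> /(ler_wpM2l (mulr_ge0 c0 (ltW (r_gt0 0)))).
by have := mulr_ge0 k0 (defect_ge0 0); lra.
Qed.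

(** Points that may be joined to a point that is not flat. *)
Definition close_to_nonflat n x := has (fun y => ~~ flat n y && (d x y <=
  2 * L * r n)) (xs n).

Definition forest_cost : R := 8 * (6 * (4 * L) + 2).

Lemma close_to_nonflat_count n : (count (close_to_nonflat n) (xs n))%:R * r n <=
  forest_cost * defect n.
Proof.
have hL := HL; have hA := HA.
rewrite /forest_cost [8 * _]mulrC -mulrA; apply: (@le_trans _ _ ((6 * (4 * L) +
  2) * (nonflat n * r n))).
  rewrite mulrA ler_wpM2r ?(ltW (r_gt0 n))//.
  rewrite -sum1_countR (bigID (flat n)) /=.
  have h1 : \sum_(x <- xs n | close_to_nonflat n x && ~~ flat n x) 1 <= nonflat n.
    by rewrite sum1_countR ler_nat; apply: sub_count => x /= /andP[].
  have h2 : \sum_(x <- xs n | close_to_nonflat n x && flat n x) 1 <= (6 * (4 * L) +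
    1) * nonflat n.
    apply: (@le_trans _ _ (\sum_(y <- xs n | ~~ flat n y) \sum_(x <- xs n |
        (close_to_nonflat n x && flat n x) && (d x y <= 2 * L * r n)) 1)).
      by apply: charge => // x _ /andP[/hasP[y ys /andP[fy xy]] _]; exists y.
    rewrite /nonflat -sum1_countR mulr_sumr; apply: ler_sum => y _.
    rewrite mulr1 sum1_countR.
    apply: (@le_trans _ _ (count (fun u => flat n u && (d u y <= 2 * L * r n)) (xs n))%:R).
      by rewrite ler_nat; apply: sub_count => x /= /andP[/andP[_ ->] ->].
    by apply: count_flat_near; lra.
  by lra.
by rewrite ler_wpM2l ?nonflat_defect//; lra.
Qed.

(** No third point is in the lune of [u] and its nearest neighbour, so the two are
joined if that neighbour is flat. *)
Lemma flat_degree n u : u \in xs n -> flat n u -> (0 < ends n u)%N \/ close_to_nonflat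
  n u \/
  exists2 v, v \in xs n & short_edge n (u, v).
Proof.
move=> us fu; case E: (nbrs n u) => [|x t]; first by left; rewrite /ends E.
right; have [|v [vN _ vmin]] := @seq_argmax R _ (nbrs n u) (fun v => - d u v) predT.
  by rewrite E.
move: (vN); rewrite mem_filter => /andP[/andP[vu uv] vs].
have [fv|nfv] := boolP (flat n v); last first.
  left; apply/hasP; exists v => //; rewrite nfv /=.
  by have := Lr n; have := r_gt0 n; lra.
right; exists v => //; rewrite /short_edge uv andbT.
apply/and4P; split=> //=; first by rewrite eq_sym.
apply/allP => z zs /=; rewrite !leNgt -negb_and; apply/negP => /andP[uz zv].
have zu : z != u by apply: contraTneq zv => ->; rewrite ltxx.
have : z \in nbrs n u by rewrite mem_filter zu zs (lt_trans uz uv).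
by move=> /vmin/(_ isT); rewrite lerN2 leNgt uz.
Qed.

(** By [flat_degree] every vertex is charged to an edge, an end or a point that is not
flat. *)
Lemma size_net n : (size (xs n))%:R * r n <=
  flength n + r n * nends n + (forest_cost + 8) * defect n.
Proof.
have r0 := r_gt0 n.
pose E u := has (fun v => short_edge n (u, v)) (xs n).
have split4 : (size (xs n))%:R * r n <= \sum_(u <- xs n | E u) r n +
    r n * nends n + (count (close_to_nonflat n) (xs n))%:R * r n + nonflat n * r n.
  have -> : (size (xs n))%:R = \sum_(u <- xs n) 1 :> R by rewrite sum1_countR count_predT.
  rewrite /nonflat -!sum1_countR /nends mulr_sumr !mulr_suml.
  rewrite [\sum_(u <- _ | E u) _]big_mkcond [\sum_(u <- _ | flat n u) _]big_mkcond.
  rewrite [\sum_(u <- _ | close_to_nonflat n u) _]big_mkcond [\sum_(u <- _ | ~~ _)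
    _]big_mkcond.
  rewrite -!big_split [leLHS]big_seq [leRHS]big_seq /=; apply: ler_sum => u us.
  have e0 : 0 <= r n * (ends n u)%:R by rewrite mulr_ge0// ltW.
  case: (boolP (flat n u)) => [fu|nf] /=; last by case: ifP; case: ifP; lra.
  have [eu|[->|[v vs uv]]] := flat_degree us fu; last first.
  - have -> : E u by apply/hasP; exists v.
    by case: ifP; lra.
  - by case: ifP; lra.
  - have : r n <= r n * (ends n u)%:R by rewrite ler_peMr ?ler1n// ltW.
    by case: ifP; case: ifP; lra.
have : \sum_(u <- xs n | E u) r n <= flength n.
  apply: (@le_trans _ _ (\sum_(g <- pairs (xs n) | short_edge n g)
      \sum_(u <- xs n | E u && (g.1 == u)) r n)).
    apply: charge => [_|u us /hasP[v vs uv]]; first exact: ltW.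
    by exists (u, v); split; rewrite // mem_pairs us.
  rewrite /flength big_seq_cond [leRHS]big_seq_cond; apply: ler_sum => -[a b].
  rewrite mem_pairs => /andP[/andP[/= As bs] /andP[/and4P[/= nab _ _ _] _]].
  apply: (@le_trans _ _ (1 * r n)); last by rewrite mul1r ltW// xs_sep.
  apply: sum_le_count => //; first exact: ltW.
  by rewrite (ler_nat R _ 1); apply: count_le1 => // x y _ _ /andP[_ /eqP<-] /andP[_
    /eqP<-].
have := close_to_nonflat_count n; have := nonflat_defect n; rewrite mulrDl; lra.
Qed.


(** * Connecting the nets *)

(** Near points that are not flat there is no control on the number of pairs, as in
infinite dimension many points can be at the same distance from each other. A
spanning forest needs only as many pairs as there are points, and these are
comparable in number to the points that are not flat. *)
Lemma repair_forest n : exists t : seq (V * V), [/\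
  forall e, e \in t -> [/\ e.1 \in xs n, e.2 \in xs n & d e.1 e.2 < 2 * L * r n],
  (size t <= count (close_to_nonflat n) (xs n))%N &
  forall u v, u \in xs n -> v \in xs n -> d u v < 2 * L * r n ->
    ~~ (flat n u && flat n v) -> linked (fun x y => (x, y) \in t) u v].
Proof.
pose s := [seq x <- xs n | close_to_nonflat n x].
have [|t [tl ts tc]] := @spanning_forest V s [seq e <- pairs s | d e.1 e.2 < 2 * L * r n].
  by move=> e; rewrite mem_filter => /andP[].
exists t; split.
- move=> e /tl; rewrite mem_filter mem_pairs !mem_filter.
  by move=> /andP[-> /andP[/andP[_ ->] /andP[_ ->]]].
- by move: ts; rewrite size_filter.
move=> u v us vs uv; rewrite negb_and => nf; apply: (tc (u, v)).
rewrite mem_filter uv mem_pairs !mem_filter us vs !andbT /=.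
have Lr0 : 0 <= 2 * L * r n by have := Lr n; have := r_gt0 n; lra.
by case/orP: nf => nf; apply/andP; split; apply/hasP;
  [exists u|exists u|exists v|exists v]; rewrite // nf /= ?d0 ?(dC v u) ?(ltW uv).
Qed.

Lemma count_ltn (T : eqType) (s : seq T) (P Q : pred T) x : uniq s ->
  (forall y, P y -> Q y) -> x \in s -> Q x -> ~~ P x -> (count P s < count Q s)%N.
Proof.
move=> us PQ xs' Qx Px; rewrite -!size_filter.
apply: (@uniq_leq_size _ (x :: [seq y <- s | P y])).
  by rewrite /= mem_filter (negPf Px) filter_uniq.
move=> y; rewrite inE !mem_filter => /orP[/eqP->|/andP[/PQ -> ->]//].
by rewrite Qx.
Qed.

Section Connectivity.
Variable t : nat -> seq (V * V).
Hypothesis t_link : forall n u v, u \in xs n -> v \in xs n -> d u v < 2 * L * r n ->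
    ~~ (flat n u && flat n v) -> linked (fun x y => (x, y) \in t n) u v.

Let step N u v := (exists n, (n <= N)%N /\ (u, v) \in bridges n ++ t n) \/
  [/\ u \in xs N, v \in xs N & d u v < L * r N].

(** Pairs at twice the current length scale are refined through the points of
their lune, until an edge or a pair at the current scale is met. *)
Lemma refine N u v : u \in xs N.+1 -> v \in xs N.+1 -> d u v < 2 * L * r N.+1 ->
  linked (step N.+1) u v.
Proof.
pose m u v := count (fun e => d e.1 e.2 < d u v) (pairs (xs N.+1)).
have [k] := ubnP (m u v); elim: k u v => // k IH u v; rewrite ltnS => mk us vs uv.
have [uv1|uv1] := ltP (d u v) (L * r N.+1); first by apply: linked1; right.
have [->|nuv] := eqVneq u v; first exact: linked0.
have [/andP[fu fv]|nf] := boolP (flat N.+1 u && flat N.+1 v); last first.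
  apply: linked_sub (t_link us vs uv nf) => x y xy; apply: linked1; left.
  by exists N.+1; rewrite mem_cat xy orbT.
have [lf|] := boolP (lune_free (xs N.+1) (u, v)); last first.
  move=> /allPn[z zs /=]; rewrite negb_or -!ltNge => /andP[uz zv].
  have smaller x y : x \in xs N.+1 -> y \in xs N.+1 -> d x y < d u v ->
      linked (step N.+1) x y.
    move=> xS yS xy; apply: IH => //; last exact: lt_trans xy uv.
    apply: leq_trans mk; apply: (@count_ltn _ _ _ _ (x, y)) => //=.
    - exact/uniq_pairs.
    - by move=> e /lt_trans; apply.
    - by rewrite mem_pairs xS yS.
    - by rewrite ltxx.
  by apply: (linked_trans (smaller u z us zs uz)); exact: smaller.
have le : long_edge N.+1 (u, v) by rewrite /long_edge /rng /= nuv fu fv lf uv1 uv.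
have [/hasP[[g h] gh /andP[/= ug vh]]|np] := boolP (has (parallel N (u, v)) (bridges N)).
  have [] := mem_bridges gh; rewrite mem_pairs => /andP[/= gs hs] _.
  have near x y : x \in xs N.+1 -> y \in xs N.+1 -> d x y <= 2 * r N ->
      linked (step N.+1) x y.
    move=> xS yS xy; apply: linked1; right; split=> //.
    by have := Lr N; have := r_gt0 N; rewrite rS; lra.
  apply: (linked_trans (near u g us (xs_sub gs) ug)).
  apply: (@linked_trans _ _ _ h).
    by apply: linked1; left; exists N; rewrite leqnSn mem_cat gh.
  by apply: linked_sym; apply: near => //; exact: xs_sub.
apply: linked1; left; exists N.+1; split=> //.
by rewrite mem_cat /= mem_filter le np mem_pairs us vs.
Qed.

(** A short link of scale [N] is refined at scale [N.+1]; the new points are close to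
their parents. *)
Lemma net_linked N u v : u \in xs N -> v \in xs N -> linked (step N) u v.
Proof.
elim: N u v => [|N IH] u v.
  by have [x ->] := xs0; rewrite !inE => /eqP-> /eqP->; exact: linked0.
have up x : x \in xs N.+1 -> exists2 p, p \in xs N & linked (step N.+1) x p.
  move=> xS; have [p ps xp] := xs_cov xS; exists p => //; apply: linked1; right.
  split=> //; first exact: xs_sub.
  by have := Lr N; have := r_gt0 N; rewrite rS; lra.
move=> /up[p ps up_] /up[q qs vq].
apply: (linked_trans up_); apply: (linked_trans _ (linked_sym vq)).
apply: linked_sub (IH p q ps qs) => x y [[n [nN xy]]|[xS yS xy]].
  by apply: linked1; left; exists n; rewrite (leq_trans nN).
apply: refine; rewrite ?xs_sub//.
by move: xy; rewrite rS; lra.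
Qed.

End Connectivity.

Definition graph_cost : R := 5 * (4 * end_cost + 2 * defect_cost) + forest_cost + 8 +
  2 * L * forest_cost.

Lemma graph_cost_ge0 : 0 <= graph_cost.
Proof.
have hL := HL; have k3 := defect_cost_ge0; have c0 : 0 <=
  end_cost by rewrite /end_cost; lra.
have k4 : 0 <= forest_cost by rewrite /forest_cost; lra.
have := mulr_ge0 (le_trans (ler0n R 20) hL) k4; rewrite /graph_cost; lra.
Qed.

(** What the metric part provides: edges kept for ever whose total length, together with
the size of the nets, is controlled by the defects, and which make each net
connected up to links that are short at its scale. *)
Lemma nets_graph : exists ed : nat -> seq (V * V), [/\
  forall n e, e \in ed n -> [/\ e.1 \in xs n, e.2 \in xs n & d e.1 e.2 < 2 * L * r n],
  forall N, \sum_(n < N.+1) \sum_(e <- ed n) d e.1 e.2 + (size (xs N))%:R * r N <=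
    graph_cost * (r 0 + \sum_(n < N.+1) defect n) &
  forall N u v, u \in xs N -> v \in xs N ->
    linked (fun x y => (exists n, (n <= N)%N /\ (x, y) \in ed n) \/
      [/\ x \in xs N, y \in xs N & d x y < L * r N]) u v].
Proof.
have [t ht] := choice repair_forest.
exists (fun n => bridges n ++ t n); split; last first.
- by apply: net_linked => n u v us vs; have [_ _] := ht n; apply.
- move=> N; have hL := HL; have c0 : 0 <= end_cost by rewrite /end_cost; lra.
  have k30 := defect_cost_ge0; have k40 : 0 <= forest_cost by rewrite /forest_cost; lra.
  have D0 M : 0 <= \sum_(n < M) defect n by apply: sumr_ge0 => n _; exact: defect_ge0.
  have b0 : 0 <= \sum_(n < N.+1) blength n.
    by apply: sumr_ge0 => n _; apply: sumr_ge0.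
  have f0 n : 0 <= flength n by apply: sumr_ge0.
  have e0 n : 0 <= r n * nends n.
    by apply: mulr_ge0; [exact: ltW|apply: sumr_ge0].
  have forest : \sum_(n < N.+1) \sum_(e <- t n) d e.1 e.2 <=
      2 * L * forest_cost * \sum_(n < N.+1) defect n.
    rewrite mulr_sumr; apply: ler_sum => n _.
    apply: (@le_trans _ _ ((count (close_to_nonflat n) (xs n))%:R * (2 * L * r n))).
      apply: sum_le_count; first by rewrite mulr_ge0 ?(ltW (r_gt0 n))//; lra.
        by have [h _ _] := ht n => e /h[_ _ /ltW].
      by rewrite ler_nat count_predT; have [_ h _] := ht n.
    rewrite mulrCA -mulrA ler_wpM2l ?close_to_nonflat_count//; lra.
  have p := potential_sum N; have s := size_net N.
  have dN : defect N <= \sum_(n < N.+1) defect n by rewrite big_ord_recr lerDr /= D0.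
  under eq_bigr do rewrite big_cat /=; rewrite big_split /= -/(blength _).
  have r0 := r_gt0 0.
  have q1 : forest_cost * defect N <= forest_cost * \sum_(n < N.+1) defect n by rewrite
    ler_wpM2l.
  have e1 : r N * nends N <= 2 * end_cost * (r N * nends N).
    by rewrite ler_peMl// /end_cost; lra.
  have q2 : 0 <= forest_cost * r 0 by rewrite mulr_ge0// ltW.
  have q3 : 0 <= end_cost * r 0 by rewrite mulr_ge0// ltW.
  have q4 : 0 <= defect_cost * r 0 by rewrite mulr_ge0// ltW.
  have q5 : 0 <= 2 * L * forest_cost * r 0 by rewrite !mulr_ge0 ?(ltW r0)//; lra.
  have q6 := mulr_ge0 k40 (D0 N.+1); have q7 := mulr_ge0 k30 (D0 N.+1).
  have q8 := mulr_ge0 c0 (D0 N.+1); have fN := f0 N; have eN := e0 N.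
  have DN := D0 N.+1.
  move: forest p s dN b0 r0 q1 e1 q2 q3 q4 q5 q6 q7 q8 fN eN DN.
  rewrite /potential /graph_cost /blength.
  move: defect_cost forest_cost end_cost (\sum_(i < N.+1) \sum_(e <- bridges i) _)
    (\sum_(i < N.+1) \sum_(e <- t i) _) (\sum_(n < N.+1) defect n) (flength N)
    (r N * nends N) (defect N) (_%:R * r N) => *; lra.
move=> n e; rewrite mem_cat => /orP[/mem_bridges[]|]; last first.
  by have [h _ _] := ht n => /h.
by rewrite mem_pairs => /andP[-> ->] /and3P[].
Qed.

End Nets.

(** * From a sequence of graphs to a connected set *)

Section Covers.
Context {R : realType} {V : normedModType R}.
Implicit Types (E K : set V) (l : seq (V * R)).

Lemma diam_le E (M : R) : 0 <= M -> (forall x y, E x -> E y -> `|x - y| <= M) ->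
  (diam E <= M%:E)%E.
Proof.
move=> M0 EM; apply: ge_ereal_sup => _ [->|[x Ex [y Ey <-]]]; first by rewrite lee_fin.
by rewrite lee_fin EM.
Qed.

Lemma diam_ge0 E : (0 <= diam E)%E.
Proof. by apply: ereal_sup_ubound; left. Qed.

Lemma diam_ge E x y : E x -> E y -> (`|x - y|%:E <= diam E)%E.
Proof. by move=> Ex Ey; apply: ereal_sup_ubound; right; exists x => //; exists y. Qed.

Lemma diam_closed_ball (c : V) (rho : R) : 0 <= rho ->
  (diam (closed_ball_ Num.norm c rho) <= (2 * rho)%:E)%E.
Proof.
move=> rho0; apply: diam_le; first lra.
rewrite /closed_ball_ => x y /= cx cy.
by have := ler_distD c x y; rewrite (distrC x c); lra.
Qed.

(** Closed balls are used because a finite union of them is closed, so that a cover of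
a set covers its closure. *)
Definition covered l E := forall x, E x -> exists2 b, b \in l & `|b.1 - x| <= b.2.

Lemma covered_closure l E : covered l E -> covered l (closure E).
Proof.
move=> lE; pose B := \big[setU/set0]_(b <- l) closed_ball_ Num.norm b.1 b.2.
have BP x : B x <-> exists2 b, b \in l & `|b.1 - x| <= b.2.
  rewrite /B; elim: (l) => [|b t IH]; first by rewrite big_nil; split => // -[].
  rewrite big_cons; split=> [[bx|/IH[c ct cx]]|[c]].
  - by exists b => //; exact: mem_head.
  - by exists c => //; rewrite inE ct orbT.
  - by rewrite inE => /orP[/eqP->|ct] cx; [left|right; apply/IH; exists c].
have cB : closed B by apply: closed_bigsetU => b _; exact: closed_closed_ball_.
move=> x Ex; apply/BP; rewrite closure_id in cB; rewrite cB.
by move: Ex; apply: closureS => y /lE/BP.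
Qed.

(** Finite covers by balls suffice here; they are completed by empty sets. *)
Lemma hausdorff1_cover E l (delta : R) : 
  (forall b, b \in l -> 0 <= b.2 /\ 2 * b.2 <= delta) -> 0 < delta -> covered l E ->
  (hausdorff1_delta delta E <= (\sum_(b <- l) 2 * b.2)%:E)%E.
Proof.
move=> lb d0 lE; pose F i := if (i < size l)%N then
  closed_ball_ Num.norm (nth (0, 0) l i).1 (nth (0, 0) l i).2 else set0.
have F0 i : (size l <= i)%N -> diam (F i) = 0%E.
  move=> li; apply/eqP; rewrite eq_le diam_ge0 andbT.
  by rewrite /F ltnNge li; apply: diam_le.
have Fl i : (i < size l)%N -> (diam (F i) <= (2 * (nth (0, 0) l i).2)%:E)%E.
  by move=> li; rewrite /F li diam_closed_ball//; have [] := lb _ (mem_nth (0, 0) li).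
apply: (@le_trans _ _ (\sum_(0 <= i <oo) diam (F i))%E).
  apply: ereal_inf_lbound; exists F => //; split.
    move=> x /lE[b bl bx]; exists (index b l) => //=.
    by rewrite /F index_mem bl nth_index.
  move=> i; have [li|li] := ltnP i (size l); last by rewrite F0// lee_fin ltW.
  apply: le_trans (Fl i li) _; rewrite lee_fin.
  by have [] := lb _ (mem_nth (0, 0) li).
rewrite (nneseries_split _ (size l)); last by move=> k _; exact: diam_ge0.
rewrite add0n eseries0 ?adde0; last by move=> i li _; exact: F0.
rewrite (big_nth (0, 0)) -sumEFin big_nat [leRHS]big_nat.
by apply: lee_sum => i /andP[_ li]; exact: Fl.
Qed.

Definition segm (u v : V) : set V := [set u + t *: (v - u) | t in `[0, 1]].

Lemma segm_l u v : segm u v u.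
Proof. by exists 0; rewrite /= ?in_itv/= ?lexx ?ler01// scale0r addr0. Qed.

Lemma segm_r u v : segm u v v.
Proof. by exists 1; rewrite /= ?in_itv/= ?lexx ?ler01// scale1r addrC subrK. Qed.

Lemma segm_dist u v z : segm u v z -> `|u - z| <= `|u - v|.
Proof.
move=> [t]; rewrite /= in_itv/= => /andP[t0 t1] <-.
rewrite opprD addNKr normrN normrZ ger0_norm// distrC.
by rewrite ler_piMl.
Qed.

Lemma segm_connected u v : connected (segm u v).
Proof.
apply: connected_continuous_connected; first exact: segment_connected.
apply: continuous_subspaceT => t.
apply: cvgD; first exact: cvg_cst.
by apply: cvgZr_tmp; exact: cvg_id.
Qed.

(** Equal pieces, each in the ball that has the piece as a diameter. *)
Lemma segm_cover u v (delta : R) : 0 < delta -> exists l : seq (V * R),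
  [/\ covered l (segm u v), \sum_(b <- l) 2 * b.2 <= `|u - v| &
     forall b, b \in l -> 0 <= b.2 /\ 2 * b.2 <= delta].
Proof.
move=> d0; pose k := (Num.truncn (`|u - v| / delta)).+1.
have kR : 0 < k%:R :> R by rewrite ltr0n.
have kd : `|u - v| / k%:R <= delta.
  rewrite ler_pdivrMr// mulrC -ler_pdivrMr//.
  by apply/ltW; rewrite truncnS_gt.
pose rho : R := `|u - v| / k%:R / 2.
have rho0 : 0 <= rho by rewrite /rho !divr_ge0.
pose c (i : nat) : V := u + ((i%:R + 1 / 2) / k%:R) *: (v - u).
pose s := iota 0 k.
exists [seq (c i, rho) | i <- s]; split; last first.
- by move=> b /mapP[i _ ->] /=; split=> //; rewrite /rho; lra.
- rewrite big_map (eq_bigr (fun=> 2 * rho))// big_const_seq iter_addr_0 count_predT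
  size_iota /rho.
  have -> : 2 * (`|u - v| / k%:R / 2) = `|u - v| / k%:R by lra.
  by rewrite -[leLHS]mulr_natr divfK// lt0r_neq0.
move=> _ [t tI <-]; have /andP[t0 t1] : 0 <= t <= 1 by move: tI; rewrite /= in_itv.
have tk0 : 0 <= t * k%:R by rewrite mulr_ge0.
pose i := minn (Num.truncn (t * k%:R)) k.-1.
have [i1 i2] : i%:R <= t * k%:R /\ t * k%:R <= i%:R + 1.
  have /andP[h1 h2] := truncn_itv tk0; rewrite /i /minn; case: ltnP => h.
    by rewrite h1; split=> //; rewrite natr1 ltW.
  split; first by apply: le_trans h1; rewrite ler_nat.
  by rewrite natr1 /= ler_piMl.
exists (c i, rho).
  by apply/mapP; exists i => //; rewrite mem_iota add0n ltnS geq_minr.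
rewrite /= /c opprD addrACA subrr add0r -scalerBl normrZ (distrC v).
rewrite /rho -[leRHS]mulrA [leRHS]mulrC ler_wpM2r//.
have -> : (i%:R + 1 / 2) / k%:R - t = (i%:R + 1 / 2 - t * k%:R) / k%:R.
  by rewrite mulrBl mulfK// lt0r_neq0.
rewrite normrM normfV (ger0_norm (ltW kR)) mulrC ler_wpM2l ?invr_ge0//.
by rewrite ler_norml; lra.
Qed.

(** Total boundedness: an ultrafilter on [G] contains arbitrarily small balls of the
covers, so it is Cauchy. *)
Lemma compact_covered (G : set V) :
  (forall F : set_system V, UltraFilter F -> cauchy F -> exists p : V, F --> p) ->
  closed G ->
  (forall e : R, 0 < e -> exists l, covered l G /\ forall b, b \in l -> b.2 < e) ->
  compact G.
Proof.
move=> cmpl cG cov; rewrite compact_ultra => F FU FG.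
have [p Fp] : exists p : V, F --> p.
  apply: cmpl; apply: cauchy_exP => e e0; have [l [lG le]] := cov e e0.
  suff : exists2 b, b \in l & F (ball b.1 e) by case=> b _ Fb; exists b.1.
  have : F (\bigcup_(b in [set` l]) ball b.1 e).
    apply: filterS FG => x /lG[b bl bx]; exists b => //.
    by rewrite -ball_normE /=; apply: le_lt_trans bx (le b bl).
  elim: (l) {lG le} => [|b t IH].
    rewrite (_ : \bigcup_(_ in _) _ = set0); last first.
      by apply/seteqP; split=> // x [].
    by move=> /filter_not_empty.
  move=> Fu; have [Fb|Fb] := in_ultra_setVsetC (ball b.1 e) FU.
    by exists b; rewrite ?mem_head.
  have [|c ct Fc] := IH; last by exists c; rewrite // inE ct orbT.
  apply: filterS (filterI Fu Fb) => x [[c /=]]; rewrite inE => /orP[/eqP->//|ct cx _].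
  by exists c.
exists p; split=> //=; rewrite closure_id in cG; rewrite cG.
move=> B /Fp FB; have [x Gx] := filter_ex (filterI FG FB).
by exists x.
Qed.

End Covers.

Lemma halving_lt {R : realType} (r : nat -> R) (e : R) :
  (forall n, 0 < r n) -> (forall n, r n.+1 = r n / 2) -> 0 < e ->
  exists N, forall n, (N <= n)%N -> r n < e.
Proof.
move=> r0 rS e0; have rn n : r n * n%:R <= r 0.
  suff : r n * (2 ^ n)%:R <= r 0.
    by apply: le_trans; rewrite ler_pM2l// ler_nat ltnW// ltn_expl.
  elim: n => [|n IH]; first by rewrite mulr1.
  by rewrite rS expnS natrM; move: IH; set X := (2 ^ n)%:R; lra.
exists (Num.truncn (r 0 / e)).+1 => n Nn.
have n0 : 0 < n%:R :> R by rewrite ltr0n (leq_trans _ Nn).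
rewrite -(ltr_pM2r n0); apply: (le_lt_trans (rn n)).
rewrite mulrC -ltr_pdivrMr//; apply: (@lt_le_trans _ _ (Num.truncn (r 0 / e)).+1%:R).
  exact: truncnS_gt.
by rewrite ler_nat.
Qed.

(** [xs n] is a net of [K] at scale [r n], and the edges of [ed n] are kept for ever. *)
Section LimitSet.
Context {R : realType} {V : normedModType R}.
Context (K : set V) (xs : nat -> seq V) (r : nat -> R) (ed : nat -> seq (V * V)).
Context (L M : R).
Hypothesis complete : forall F : set_system V, UltraFilter F -> cauchy F ->
  exists p : V, F --> p.
Hypotheses (r_gt0 : forall n, 0 < r n) (rS : forall n, r n.+1 = r n / 2).
Hypothesis xsK : forall n x, x \in xs n -> K x.
Hypothesis xs_cov : forall n y, K y -> exists2 x, x \in xs n & `|x - y| <= r n.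
Hypothesis L1 : 1 <= L.
Hypothesis edH : forall n e, e \in ed n ->
  [/\ e.1 \in xs n, e.2 \in xs n & `|e.1 - e.2| < 2 * L * r n].
Hypothesis total : forall N, \sum_(n < N.+1) \sum_(e <- ed n) `|e.1 - e.2| +
  (size (xs N))%:R * r N <= M.
Hypothesis link : forall N u v, u \in xs N -> v \in xs N ->
    linked (fun x y => (exists n, (n <= N)%N /\ (x, y) \in ed n) \/
      [/\ x \in xs N, y \in xs N & `|x - y| < L * r N]) u v.

Let edges : set V := [set z | exists n e, e \in ed n /\ segm e.1 e.2 z].

Definition limit_set : set V := closure (K `|` edges).

Let r_le m n : (m <= n)%N -> r n <= r m.
Proof.
elim: n => [|n IH]; first by rewrite leqn0 => /eqP->.
rewrite leq_eqVlt => /orP[/eqP->//|]; rewrite ltnS => /IH; apply: le_trans.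
by have := r_gt0 n; rewrite rS; lra.
Qed.

Lemma segms_cover (s : seq (V * V)) (delta : R) : 0 < delta -> exists l : seq (V * R),
  [/\ forall e, e \in s -> covered l (segm e.1 e.2),
      \sum_(b <- l) 2 * b.2 <= \sum_(e <- s) `|e.1 - e.2| &
      forall b, b \in l -> 0 <= b.2 /\ 2 * b.2 <= delta].
Proof.
move=> d0; elim: s => [|e s [l [lc ls lb]]]; first by exists [::]; rewrite !big_nil.
have [l' [lc' ls' lb']] := segm_cover e.1 e.2 d0.
exists (l' ++ l); split.
- move=> e'; rewrite inE => /orP[/eqP->|/lc h] z.
    by move=> /lc'[b bl bz]; exists b; rewrite // mem_cat bl.
  by move=> /h[b bl bz]; exists b; rewrite // mem_cat bl orbT.
- by rewrite big_cat big_cons lerD.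
- by move=> b; rewrite mem_cat => /orP[/lb'|/lb].
Qed.

(** Choose [N] with [r N] small. The edges created after stage [N] are shorter than
[2 * L * r N] and start close to [xs N], so they are covered by enlarged balls around
[xs N], together with [K]; the older ones are cut into pieces. *)
Lemma limit_set_cover (delta : R) : 0 < delta -> exists l : seq (V * R),
  [/\ covered l limit_set, \sum_(b <- l) 2 * b.2 <= (4 * L + 2) * M &
     forall b, b \in l -> 0 <= b.2 /\ 2 * b.2 <= delta].
Proof.
move=> d0; have L1' := L1; have c0 : 0 < 4 * L + 2 by lra.
have [N rN] : exists N, (4 * L + 2) * r N <= delta.
  have [N h] := halving_lt r_gt0 rS (divr_gt0 d0 c0).
  by exists N; rewrite mulrC -ler_pdivlMr// ltW// h.
pose s := flatten [seq ed n | n <- iota 0 N.+1].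
have [l [lc ls lb]] := segms_cover s d0.
pose near := [seq (x, (2 * L + 1) * r N) | x <- xs N].
have nearP x z : x \in xs N -> `|x - z| <= (2 * L + 1) * r N ->
    exists2 b, b \in near ++ l & `|b.1 - z| <= b.2.
  move=> xN xz; exists (x, (2 * L + 1) * r N) => //.
  by rewrite mem_cat; apply/orP; left; apply/mapP; exists x.
have rN0 := r_gt0 N.
have rNL : 0 <= (2 * L + 1) * r N by apply: mulr_ge0; lra.
exists (near ++ l); split; last first.
- move=> b; rewrite mem_cat => /orP[/mapP[x _ ->] /=|/lb//]; split=> //; lra.
- rewrite big_cat /= big_map (eq_bigr (fun=> (4 * L + 2) * r N));
  last by move=> x _ /=; lra.
  rewrite big_const_seq iter_addr_0 count_predT -[_ *+ _]mulr_natr.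
  apply: (@le_trans _ _ ((4 * L + 2) *
      (\sum_(n < N.+1) \sum_(e <- ed n) `|e.1 - e.2| + (size (xs N))%:R * r N)));
        last first.
    by rewrite ler_pM2l.
  have -> : \sum_(n < N.+1) \sum_(e <- ed n) `|e.1 - e.2| = \sum_(e <- s) `|e.1 - e.2|.
    by rewrite /s big_flatten big_map -[iota _ _]/(index_iota 0 N.+1) big_mkord.
  have : 0 <= (4 * L + 1) * \sum_(e <- s) `|e.1 - e.2|.
    by apply: mulr_ge0; [lra|apply: sumr_ge0].
  move: ls; set S := \sum_(e <- s) _; set T := \sum_(b <- l) _.
  by set k := _%:R; lra.
apply: covered_closure => z [Kz|[n [e [en ez]]]].
  have [x xN xz] := xs_cov N Kz; apply: (nearP x) => //.
  by apply: le_trans xz _; rewrite ler_peMl//; lra.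
have [nN|Nn] := leqP n N.
  have : e \in s.
    by apply/flattenP; exists (ed n) => //; apply/mapP; exists n; rewrite // mem_iota.
  by move=> /lc/(_ z ez)[b bl bz]; exists b => //; rewrite mem_cat bl orbT.
have [e1 _ e12] := edH en; have [x xN xe] := xs_cov N (xsK e1).
apply: (nearP x) => //; have := segm_dist ez; have := ler_distD e.1 x z.
have : 2 * L * r n <= 2 * L * r N by rewrite ler_wpM2l ?r_le// ?(ltnW Nn)//; lra.
lra.
Qed.

Lemma limit_set_hausdorff1 : (hausdorff1 limit_set <= ((4 * L + 2) * M)%:E)%E.
Proof.
apply: ge_ereal_sup => _ [delta /= d0 <-].
have [l [lc ls lb]] := limit_set_cover d0.
by apply: le_trans (hausdorff1_cover lb d0 lc) _; rewrite lee_fin.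
Qed.

Lemma limit_set_compact : compact limit_set.
Proof.
apply: compact_covered => //; first exact: closed_closure.
move=> e e0; have [l [lc _ lb]] := limit_set_cover e0.
by exists l; split=> // b /lb[]; lra.
Qed.

(** A separation of the limit set would have a positive gap, by compactness,
while at fine scales all the short links are smaller than the gap and the edges
are connected. *)
Lemma limit_set_connected : connected limit_set.
Proof.
apply/connectedP => E [E0 EU [sep1 sep2]].
have L1' := L1.
have sub b z : E b z -> limit_set z by rewrite EU; case: b; [right|left].
have disj b z : E b z -> closure (E (~~ b)) z -> False.
  by case: b => /= h1 h2; [have : set0 z by rewrite -sep1|have : set0 z by rewrite -sep2].
have [delta d0 gap] : exists2 delta, 0 < delta &
    forall a b, E false a -> E true b -> delta <= `|a - b|.
  (* otherwise points of the two parts approach each other, and by compactness they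
     have a common cluster point *)
  apply: contrapT => nogap.
  have ab n : exists p : V * V, [/\ E false p.1, E true p.2 & `|p.1 - p.2| < r n].
    apply: contrapT => h; apply: nogap; exists (r n) => // a b Ea Eb.
    by rewrite leNgt; apply/negP => lt; apply: h; exists (a, b).
  have {ab} [f fP] := choice ab.
  have [|p [Gp cp]] := limit_set_compact (F := (fst \o f) @ \oo).
    by exists 0%N => // n _ /=; apply: (sub false); have [] := fP n.
  have tail N : ((fst \o f) @ \oo) [set a | exists2 n, (N <= n)%N & a = (f n).1].
    by exists N => // n Nn /=; exists n.
  have cl0 : closure (E false) p.
    move=> B pB; have [a [[n _ ->] Ba]] := cp _ _ (tail 0%N) pB.
    by exists (f n).1; split=> //; have [] := fP n.
  have cl1 : closure (E true) p.
    move=> B; rewrite -nbhs_ballE => -[e /= e0 eB].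
    have e20 : 0 < e / 2 by lra.
    have [N rN] := halving_lt r_gt0 rS e20.
    have [a [[n Nn ->] pa]] := cp _ _ (tail N) (nbhsx_ballx p (e / 2) e20).
    have [_ h2 h3] := fP n; exists (f n).2; split=> //; apply: eB.
    move: pa; rewrite -!ball_normE /=.
    have := ler_distD (f n).1 p (f n).2; have := rN n Nn; lra.
  by move: Gp; rewrite EU => -[h|h]; [apply: (disj _ _ h)|apply: (disj _ _ h)].
have [N LN] : exists N, L * r N < delta.
  have [|N h] := halving_lt r_gt0 rS (e := delta / L); first by apply: divr_gt0; lra.
  by exists N; rewrite mulrC -ltr_pdivlMr ?h//; lra.
have KG z : K z -> limit_set z by move=> Kz; apply: subset_closure; left.
have close z w : limit_set z -> limit_set w -> `|z - w| < delta ->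
    forall b, E b z -> E b w.
  move=> Gz Gw zw b Ez; move: Gw; rewrite EU => -[Ew|Ew]; case: b Ez => // Ez.
    by have := gap w z Ew Ez; rewrite distrC; lra.
  by have := gap z w Ez Ew; lra.
have seg n e b z w : e \in ed n -> segm e.1 e.2 z -> segm e.1 e.2 w -> E b z -> E b w.
  move=> en ez ew Ez.
  have sG : segm e.1 e.2 `<=` E false `|` E true.
    by rewrite -EU => x ex; apply: subset_closure; right; exists n, e.
  have dis2 x : E false x -> E true x -> False.
    by move=> h1 /subset_closure h2; exact: (disj false x).
  have [h|h] := connected_subset (conj sep1 sep2) sG (@segm_connected _ _ _ _).
    by case: b Ez => Ez; [case: (dis2 z (h z ez) Ez)|exact: h].
  by case: b Ez => Ez; [exact: h|case: (dis2 z Ez (h z ez))].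
have same x y : linked (fun x y => (exists n, (n <= N)%N /\ (x, y) \in ed n) \/
      [/\ x \in xs N, y \in xs N & `|x - y| < L * r N]) x y ->
    forall b, E b x -> E b y.
  elim=> // {}x w z xw _ IH b Ex; apply: IH.
  case: xw => -[[n [_ xwn]]|[xN wN xw]].
  - by apply: (seg n (x, w)) Ex => //; [exact: segm_l|exact: segm_r].
  - by apply: (close x w _ _ _ b Ex); [exact/KG/(xsK xN)|exact/KG/(xsK wN)|lra].
  - by apply: (seg n (w, x)) Ex => //; [exact: segm_r|exact: segm_l].
  - by apply: (close x w _ _ _ b Ex);
      [exact/KG/(xsK wN)|exact/KG/(xsK xN)|rewrite distrC; lra].
have [K0|[x0 Kx0]] : (forall x, ~ K x) \/ exists x, K x.
  by have [h|h] := pselect (exists x, K x); [right|left => x Kx; apply: h; exists x].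
  have [z /sub Gz] := E0 true; have [y [[/K0[]|[n [e [/edH[/xsK/K0[]]]]]] _]] :=
    Gz _ filterT.
have [x xN _] := xs_cov N Kx0.
have [b Ebx] : exists b, E b x.
  by have := KG _ (xsK xN); rewrite EU => -[]; [exists false|exists true].
have KE z : K z -> E b z.
  move=> Kz; have [y yN yz] := xs_cov N Kz.
  apply: (close y z) (same x y (link xN yN) b Ebx); [exact/KG/(xsK yN)|exact: KG|].
  apply: le_lt_trans yz (le_lt_trans _ LN); rewrite ler_peMl//.
  exact: ltW.
have SE : K `|` edges `<=` E b.
  move=> z [/KE//|[n [e [en ez]]]]; have [/xsK/KE Ee _ _] := edH en.
  by apply: (seg n e b e.1 z) => //; exact: segm_l.
have [z Ez] := E0 (~~ b); apply: (disj (~~ b) z Ez); rewrite negbK.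
by move: (sub _ _ Ez); apply: closureS.
Qed.

End LimitSet.
(** * Hilbert space *)

Lemma ler_normB2 (R : numDomainType) (V : normedZmodType R) (x y : V) (h : R) :
  `|x| <= h -> `|y| <= h -> `|x - y| <= 2 * h.
Proof.
by move=> xh yh; rewrite mulr_natl mulr2n (le_trans (ler_normB _ _))// lerD.
Qed.

Section Hilbert.
Context {R : realType}.
Implicit Types x y z e : ell2 R.

Lemma ell2D x y i : (x + y) i = x i + y i.
Proof. by []. Qed.

Lemma ell2B x y i : (x - y) i = x i - y i.
Proof. by []. Qed.

Lemma ell2Z (a : R) x i : (a *: x) i = a * x i.
Proof. by []. Qed.

Lemma ell2_sqr_norm x : `|x| ^+ 2 = limn (sqseries x).
Proof. exact/l2norm_sqr/valP. Qed.

Lemma ell2_sqr_cvg x : sqseries x @ \oo --> `|x| ^+ 2.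
Proof. by rewrite ell2_sqr_norm; exact/sqsummableP/valP. Qed.

(** The inner product, obtained from the norm by polarization. *)
Definition dot x y : R := (`|x + y| ^+ 2 - `|x - y| ^+ 2) / 4.

Lemma dot_cvg x y : series (fun i => x i * y i) @ \oo --> dot x y.
Proof.
have -> : series (fun i => x i * y i) =
    (fun n => (sqseries (x + y) n - sqseries (x - y) n) / 4).
  apply/funext => n; rewrite /sqseries /series /= -sumrB mulr_suml.
  apply: eq_bigr => i _.
  suff : x i * y i = ((x + y) i ^+ 2 - (x - y) i ^+ 2) / 4 by [].
  by rewrite ell2D ell2B; field.
by apply: cvgMr_tmp; apply: cvgB; exact: ell2_sqr_cvg.
Qed.

Lemma dotC x y : dot x y = dot y x.
Proof. by rewrite /dot (addrC x) (distrC x). Qed.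

Lemma dotxx x : dot x x = `|x| ^+ 2.
Proof.
rewrite /dot subrr normr0 -mulr2n -scaler_nat normrZ ger0_norm// exprMn.
by field.
Qed.

Lemma dotDZ (a : R) x y z : dot (x + a *: y) z = dot x z + a * dot y z.
Proof.
have c : series (fun i => (x + a *: y) i * z i) @ \oo --> dot x z + a * dot y z.
  have -> : series (fun i => (x + a *: y) i * z i) =
      (fun n => series (fun i => x i * z i) n + a * series (fun i => y i * z i) n).
    apply/funext => n; rewrite /series /= mulr_sumr -big_split /=.
    apply: eq_bigr => i _.
    suff : (x + a *: y) i * z i = x i * z i + a * (y i * z i) by [].
    by rewrite ell2D ell2Z mulrDl mulrA.
  by apply: cvgD; [exact: dot_cvg|apply: cvgMl_tmp; exact: dot_cvg].
exact: (cvg_unique (@Rhausdorff R) (@dot_cvg (x + a *: y) z) c).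
Qed.

Lemma pythagoras x e : `|e| = 1 -> `|x| ^+ 2 = dot x e ^+ 2 + `|x - dot x e *: e| ^+ 2.
Proof.
move=> e1; rewrite -[`|x - _| ^+ 2]dotxx -[in RHS]scaleNr dotDZ.
rewrite [dot x (_ + _)]dotC [dot e (_ + _)]dotC !dotDZ !dotxx e1 (dotC e x).
by ring.
Qed.

(** The coordinate is the projection to the line; the components orthogonal to the line
are bounded by [2 * h], and by Pythagoras they enter squared. *)
Lemma tube_coordinate (E : set (ell2 R)) (p v : ell2 R) (h : R) : v != 0 ->
  (forall z, E z -> exists t, `|z - (p + t *: v)| <= h) ->
  exists pi : ell2 R -> R, forall y z, E y -> E z ->
    `|pi y - pi z| <= `|y - z| /\ `|y - z| ^+ 2 <= (pi y - pi z) ^+ 2 + 4 * h ^+ 2.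
Proof.
move=> v0 tube; pose e := `|v|^-1 *: v.
have nv : 0 < `|v| by rewrite normr_gt0.
have e1 : `|e| = 1 by rewrite normrZ normfV normr_id mulVf// lt0r_neq0.
have dotB x y z : dot (x - y) z = dot x z - dot y z.
  by rewrite -scaleN1r dotDZ mulN1r.
exists (dot^~ e) => y z Ey Ez; rewrite -dotB.
have pyth := pythagoras (y - z) e1; split.
  rewrite -ler_sqr ?nnegrE// real_normK ?num_real// pyth lerDl.
  exact: sqr_ge0.
rewrite pyth lerD2l.
have [s hs] := tube y Ey; have [t ht] := tube z Ez.
pose w := (y - (p + s *: v)) - (z - (p + t *: v)).
have wE : y - z = w + ((s - t) * `|v|) *: e.
  rewrite /e scalerA mulfK ?lt0r_neq0// scalerBl.
  suff -> : w = y - z - (s *: v - t *: v) by rewrite subrK.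
  rewrite /w [- (z - _)]opprD opprK addrACA; congr (_ + _).
  by rewrite opprD [LHS]addrACA addNr add0r opprB addrC.
have perp : y - z - dot (y - z) e *: e = w - dot w e *: e.
  rewrite wE dotDZ dotxx e1 expr1n mulr1 scalerDl opprD addrACA.
  by rewrite [_ *: e - _]subrr addr0.
have wh : `|w| <= 2 * h := ler_normB2 hs ht.
rewrite perp; apply: (@le_trans _ _ (`|w| ^+ 2)).
  by rewrite (pythagoras w e1) lerDr sqr_ge0.
have -> : 4 * h ^+ 2 = (2 * h) ^+ 2 by ring.
have h0 : 0 <= 2 * h := le_trans (normr_ge0 w) wh.
exact: (lerXn2r 2 (normr_ge0 w) h0 wh).
Qed.

Lemma ell2_coord_le x i : `|x i| <= `|x|.
Proof.
rewrite -ler_sqr ?nnegrE// real_normK ?num_real//.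
apply: le_trans (sqseries_le i.+1 (valP x)).
rewrite /sqseries /series /= big_nat_recr//= lerDr.
by apply: sumr_ge0 => j _; exact: sqr_ge0.
Qed.

(** The limit is taken coordinatewise; the bounds on the partial sums pass to the limit
and give both its membership and the convergence in norm. *)
Lemma ell2_complete (F : set_system (ell2 R)) : UltraFilter F -> cauchy F ->
  exists p : ell2 R, F --> p.
Proof.
move=> FU /cauchy_ballP Fc.
have small (e : R) : 0 < e -> exists c : ell2 R, F (ball c e).
  move=> e0; have [[P Q] [/= FP FQ] PQ] := Fc e e0.
  have [c Pc] := filter_ex FP; exists c; apply: filterS FQ => y Qy.
  exact: (PQ (c, y)).
have coord i : cvg ((fun x : ell2 R => x i) @ F).
  apply: cauchy_cvg; apply: cauchy_exP => e e0; have [c Fce] := small e e0.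
  exists (c i); suff : F [set x : ell2 R | ball (c i) e (x i)] by [].
  apply: filterS Fce => x; rewrite -!ball_normE /=.
  move=> cx; apply: le_lt_trans cx; have := @ell2_coord_le (c - x) i.
  by rewrite ell2B.
pose p i := lim ((fun x : ell2 R => x i) @ F).
have pc (c : ell2 R) (e : R) n : F (ball c e) -> sqseries (p - ell2_seq c) n <= e ^+ 2.
  move=> Fce.
  have cv : (fun x : ell2 R => sqseries (x - c) n) @ F --> sqseries (p - ell2_seq c) n.
    rewrite /sqseries /series /=; elim: n => [|n IH].
      by under eq_fun do rewrite big_geq//; rewrite big_geq//; exact: cvg_cst.
    under eq_fun do rewrite big_nat_recr//=; rewrite big_nat_recr//=.
    apply: cvgD; first exact: IH.
    have d : (fun x : ell2 R => x n - c n) @ F --> p n - c n.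
      by apply: cvgB; [exact: coord|exact: cvg_cst].
    by rewrite expr2; under eq_fun do rewrite expr2; exact: (cvgM d d).
  rewrite -(cvg_lim (@Rhausdorff R) cv); apply: limr_le.
    by apply/cvg_ex; eexists; exact: cv.
  apply: filterS Fce => x; rewrite -ball_normE /= distrC => /ltW cx.
  apply: le_trans (sqseries_le n (valP (x - c))) _.
  by rewrite lerXn2r// nnegrE ?(le_trans _ cx)// l2norm_ge0.
have [c1 Fc1] := small 1 ltr01.
have ps : p \in sqsummable.
  have [h _] := sqsummable_bound (fun n => pc c1 1 n Fc1).
  have -> : p = (p - ell2_seq c1) + 1 *: ell2_seq c1 by rewrite scale1r subrK.
  have [_ hcl] := @sqsummable_submod_closed R.
  by rewrite addrC; apply: hcl => //; exact: valP.
exists (Ell2 ps) => B; rewrite -nbhs_ballE => -[e /= e0 eB].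
have e20 : 0 < e / 2 by lra.
have [c Fce] := small (e / 2) e20.
have pce : `|Ell2 ps - c| <= e / 2.
  have [_ h] := sqsummable_bound (fun n => pc c (e / 2) n Fce).
  rewrite -ler_sqr ?nnegrE//; last lra.
  by rewrite ell2_sqr_norm.
apply: filterS Fce => x; rewrite -ball_normE /= => cx; apply: eB.
rewrite -ball_normE /= (splitr e); apply: le_lt_trans (ler_distD c _ _) _.
exact: ler_ltD.
Qed.

Lemma ell2_unit : exists e : ell2 R, `|e| = 1.
Proof.
pose u (i : nat) : R := (i == 0%N)%:R.
have us : u \in sqsummable.
  apply: (sqsummable_bound (M := 1) _).1 => -[|n]; rewrite /sqseries /series /=.
    by rewrite big_geq.
  by rewrite big_nat_recl// /u /= expr1n big1 ?addr0// => i _; rewrite expr0n.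
have u0 : Ell2 us != 0.
  apply/eqP => /(congr1 (fun x : ell2 R => x 0%N)) /eqP.
  by rewrite [X in X == _]/(1 : R) [X in _ == X]/(0 : R) oner_eq0.
exists (`|Ell2 us|^-1 *: Ell2 us).
by rewrite normrZ normfV normr_id mulVf// normr_eq0.
Qed.

End Hilbert.

(** * Jones numbers and assembly *)

Section Balls.
Context {R : realType} {V : normedModType R} (e : V).
Hypothesis e1 : `|e| = 1.
Implicit Types x y z : V.

Lemma diam_closed_ball_eq x (rho : R) : 0 <= rho ->
  diam (closed_ball_ Num.norm x rho) = (2 * rho)%:E.
Proof.
move=> rho0; apply/eqP; rewrite eq_le diam_closed_ball//=.
have -> : 2 * rho = `|(x + rho *: e) - (x - rho *: e)|.
  have -> : (x + rho *: e) - (x - rho *: e) = 2 *: (rho *: e).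
    by rewrite scaler_nat opprB addrC addrA subrK -mulr2n.
  by rewrite !normrZ e1 mulr1 !ger0_norm.
apply: diam_ge; rewrite /closed_ball_ /=.
  by rewrite opprD addNKr normrN normrZ e1 mulr1 ger0_norm.
by rewrite opprB addrC subrK normrZ e1 mulr1 ger0_norm.
Qed.

Lemma closed_ball_inj x y (rho sigma : R) : 0 <= rho -> 0 <= sigma ->
  closed_ball_ Num.norm x rho = closed_ball_ Num.norm y sigma -> x = y /\ rho = sigma.
Proof.
move=> r0 s0 xy; have rs : rho = sigma.
  have := congr1 diam xy; rewrite !diam_closed_ball_eq// => -[]; lra.
split=> //; rewrite -rs in xy; apply/eqP; rewrite -subr_eq0 -normr_eq0.
apply/negPn/negP => nxy; have n0 : 0 < `|x - y| by rewrite lt_def nxy normr_ge0.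
have k0 : 0 <= rho / `|x - y| by rewrite divr_ge0.
have zx : closed_ball_ Num.norm x rho (x + (rho / `|x - y|) *: (x - y)).
  by rewrite /closed_ball_ /= opprD addNKr normrN normrZ ger0_norm// divfK.
rewrite xy /closed_ball_ /= distrC addrAC -{1}[x - y]scale1r -scalerDl in zx.
by move: zx; rewrite normrZ ger0_norm ?addr_ge0// mulrDl mul1r divfK//; lra.
Qed.

End Balls.

Lemma sqr_gap (R : realFieldType) (D P r eta : R) : 0 <= P -> 0 < r -> 0 < eta ->
  r / 2 < D -> D ^+ 2 <= P ^+ 2 + 4 * (r ^+ 2 * (eta / 8)) -> D <= P + eta * r.
Proof.
move=> P0 r0 e0 rD sq; rewrite leNgt; apply/negP => h.
have er0 : 0 < eta * r by rewrite mulr_gt0.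
have h1 : eta * r * (r / 2) < eta * r * D by rewrite ltr_pM2l.
have h2 : eta * r * D <= (D - P) * (D + P) by apply: ler_pM; lra.
have E : (D - P) * (D + P) = D ^+ 2 - P ^+ 2 by ring.
have E' : eta * r * (r / 2) = 4 * (r ^+ 2 * (eta / 8)) by field.
by move: h1 h2 sq; rewrite E E'; move: (eta * r * D) (D ^+ 2) (P ^+ 2) (4 * _) => *; lra.
Qed.

Section Jones.
Context {R : realType}.
Implicit Types (x y z : ell2 R) (K : set (ell2 R)).

Lemma diam_ell2_ball x (rho : R) : 0 <= rho ->
  diam (closed_ball_ Num.norm x rho) = (2 * rho)%:E.
Proof. by have [e e1] := @ell2_unit R; exact: (diam_closed_ball_eq e1). Qed.

Lemma jones_ge0 K x (rho : R) : 0 < rho ->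
  (0 <= jones_beta K (closed_ball_ Num.norm x rho))%E.
Proof.
move=> rho0; rewrite /jones_beta diam_ell2_ball ?(ltW rho0)// inver.
rewrite mulf_eq0 (gt_eqF rho0) pnatr_eq0 /= -EFinM.
apply: mule_ge0; first by rewrite lee_fin divr_ge0// mulr_ge0// ltW.
by apply: le_ereal_inf_tmp => _ [L _ <-]; apply: ereal_sup_ubound; left.
Qed.

Lemma jones_tube K y (rho b h : R) : 0 < rho ->
  jones_beta K (closed_ball_ Num.norm y rho) = b%:E -> b * rho < h ->
  exists p v, v != 0 /\ forall z, K z -> `|y - z| <= rho ->
    exists t, `|z - (p + t *: v)| <= h.
Proof.
move=> rho0; rewrite /jones_beta diam_ell2_ball ?(ltW rho0)// inver.
rewrite mulf_eq0 (gt_eqF rho0) pnatr_eq0 /= -EFinM invfM mulVKf ?pnatr_eq0//.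
set I := ereal_inf _ => jb bh.
have Ih : (I < h%:E)%E.
  rewrite ltNge; apply/negP => hI.
  have ri : (0 <= (rho^-1)%:E)%E by rewrite lee_fin invr_ge0 ltW.
  have := lee_wpmul2l ri hI; rewrite jb -EFinM lee_fin ler_pdivrMl//.
  by rewrite mulrC; lra.
have [_ [_ [p [v [v0 ->]]] <-] sup_lt] := ereal_inf_lt Ih.
exists p, v; split=> // z Kz yz.
have : (edist_inf [set (p + t *: v)%R | t in [set: R]] z < h%:E)%E.
  apply: le_lt_trans sup_lt; apply: ereal_sup_ubound; right; exists z => //.
move=> /ereal_inf_lt[_ [_ [t _ <-] <-] /ereal_inf_lt[_ [s [s0 zs] <-]]].
rewrite lte_fin => sh; exists t; move: zs; rewrite -ball_normE /= => zs.
exact: ltW (lt_trans zs sh).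
Qed.

(** Any [h > b * (A * r)] is allowed for the width of the tube. The error of
[tube_coordinate] is quadratic and concerns squared distances; for points at
distance at least [r / 2] it becomes an error of order [b ^+ 2 * r] for the
distances themselves. *)
Lemma jones_coordinate K y (A r b eta : R) : 0 < A -> 0 < r -> 0 <= b ->
  jones_beta K (closed_ball_ Num.norm y (A * r)) = b%:E -> 8 * A ^+ 2 * b ^+ 2 < eta ->
  exists pi : ell2 R -> R, forall p q, K p -> K q -> `|y - p| <= A * r ->
    `|y - q| <= A * r -> (p != q -> r / 2 < `|p - q|) ->
    `|pi p - pi q| <= `|p - q| /\ `|p - q| <= `|pi p - pi q| + eta * r.
Proof.
move=> A0 r0 b0 jb be; have Ar0 : 0 < A * r by rewrite mulr_gt0.
have e0 : 0 < eta.
  by apply: le_lt_trans be; rewrite !mulr_ge0 ?sqr_ge0// ltW.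
pose h := r * Num.sqrt (eta / 8).
have bh : b * (A * r) < h.
  rewrite /h mulrA mulrC ltr_pM2l// -[b * A]ger0_norm; last by rewrite mulr_ge0// ltW.
  rewrite -sqrtr_sqr ltr_sqrt; last by rewrite divr_gt0.
  by rewrite ltr_pdivlMr// exprMn; lra.
have [p0 [v [v0 tube]]] := jones_tube Ar0 jb bh.
have [pi piP] := tube_coordinate (E := [set z | K z /\ `|y - z| <= A * r]) v0
  (fun z Ez => tube z Ez.1 Ez.2).
exists pi => p q Kp Kq yp yq sep; have [h1 h2] := piP p q (conj Kp yp) (conj Kq yq).
split=> //; have [->|npq] := eqVneq p q.
  by rewrite !subrr !normr0 add0r mulr_ge0 ?ltW.
have hs : Num.sqrt (eta / 8) ^+ 2 = eta / 8 by apply: sqr_sqrtr; rewrite divr_ge0 ?(ltW e0).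
have h3 := sep npq; apply: sqr_gap h3 _ => //.
by move: h2; rewrite /h exprMn hs -[(pi p - pi q) ^+ 2]real_normK ?num_real.
Qed.

Lemma esum_ge_sum (T T' : choiceType) (I : set T) (a : T -> \bar R) (s : seq T')
    (g : T' -> T) : uniq s -> {in s &, injective g} -> (forall i, i \in s -> I (g i)) ->
  (\sum_(i <- s) a (g i) <= \esum_(x in I) a x)%E.
Proof.
move=> us gi Ig; apply: esum_ge; exists [set` map g s].
  split; first exact: finite_seq.
  by move=> x /= /mapP[i /Ig ? ->].
by rewrite -fsbig_seq ?map_inj_in_uniq// big_map.
Qed.

End Jones.

Section Assembly.
Context {R : realType} (A L : R) (K : set (ell2 R)) (m0 : int).
Context (X : int -> set (ell2 R)) (T : R).
Local Notation V := (ell2 R).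

Let r (n : nat) : R := 2 ^ (- (m0 + n%:Z)).
Let Y (n : nat) : set V := X (m0 + n%:Z).

Hypotheses (HL : 20 <= L) (HLbig : 4 * @end_cost R <= L) (HA : 40 * L <= A).
Hypothesis nets : forall n, is_net (r n) K (Y n).
Hypothesis Ysub : forall n, Y n `<=` Y n.+1.
Hypothesis Y0 : exists x, Y 0 = [set x].
Hypothesis total : (\esum_(Q in multires A m0 X) (jones_beta K Q ^+ 2 * diam Q) <= T%:E)%E.

Let r_gt0 n : 0 < r n. Proof. by rewrite /r exprz_gt0. Qed.

Let rS n : r n.+1 = r n / 2.
Proof.
by rewrite /r intS addrCA opprD expfzDr ?pnatr_eq0// exprN1 mulrC.
Qed.

Let A_gt0 : 0 < A.
Proof. by have := HL; have := HA; lra. Qed.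

Let r_inj : injective r.
Proof.
have lt m n : (m < n)%N -> r n < r m.
  elim: n => // n IH; rewrite ltnS leq_eqVlt => /orP[/eqP->|/IH]; rewrite rS;
  by have := r_gt0 n; lra.
move=> m n mn; case: (ltngtP m n) => // /lt; rewrite mn ltxx//.
Qed.

Let Q n x := closed_ball_ Num.norm (x : V) (A * r n).

Let b n x : R := fine (jones_beta K (Q n x)).

Let Ar_gt0 n : 0 < A * r n. Proof. exact: mulr_gt0. Qed.

Let Q_multires n x : Y n x -> multires A m0 X (Q n x).
Proof.
move=> Yx; exists (m0 + n%:Z), x; split=> //.
by rewrite lerDl.
Qed.

Let b_ge0 n x : 0 <= b n x.
Proof. by apply: fine_ge0; apply: jones_ge0. Qed.

Let bE n x : Y n x -> jones_beta K (Q n x) = (b n x)%:E.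
Proof.
move=> Yx; rewrite fineK// ge0_fin_numE ?jones_ge0// ltey; apply/eqP => binf.
have : (\sum_(i <- [:: (n, x)]) (jones_beta K (Q i.1 i.2) ^+ 2 * diam (Q i.1 i.2)) <=
  T%:E)%E.
  apply: le_trans total.
  apply: (@esum_ge_sum R _ _ _ (fun Q => (jones_beta K Q ^+ 2 * diam Q)%E) _
    (fun i : nat * V => Q i.1 i.2)) => //.
    by move=> i j; rewrite !inE => /eqP-> /eqP->.
  by move=> i; rewrite inE => /eqP->; exact: Q_multires.
rewrite big_seq1 /= binf diam_ell2_ball ?(ltW (Ar_gt0 _))// mulyy gt0_mulye//.
by rewrite lte_fin mulr_gt0.
Qed.

(** The sum over the set of balls counts each net point and scale separately, since a
ball determines its centre and its radius. *)
Lemma net_sum_le (s : seq (nat * V)) : uniq s -> (forall i, i \in s -> Y i.1 i.2) ->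
  \sum_(i <- s) b i.1 i.2 ^+ 2 * (2 * (A * r i.1)) <= T.
Proof.
move=> us sY; rewrite -lee_fin -sumEFin; apply: le_trans total.
have := @esum_ge_sum R _ _ (multires A m0 X) (fun Q => (jones_beta K Q ^+ 2 * diam Q)%E) s
    (fun i : nat * V => Q i.1 i.2) us.
have inj : {in s &, injective (fun i : nat * V => Q i.1 i.2)}.
  have [e e1] := @ell2_unit R.
  move=> [m x] [n y] _ _ /= /(closed_ball_inj e1 (ltW (Ar_gt0 m)) (ltW (Ar_gt0 n)))[-> mn].
  by rewrite (r_inj (mulfI (lt0r_neq0 A_gt0) mn)).
move=> /(_ inj (fun i si => Q_multires (sY i si))); apply: le_trans.
rewrite big_seq [leRHS]big_seq; apply: lee_sum => i si.
by rewrite (bE (sY i si)) /Q diam_ell2_ball ?(ltW (Ar_gt0 _))// EFinM EFin_expe.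
Qed.

Let eta n x := 8 * A ^+ 2 * b n x ^+ 2.

Let Y_coordinate n x e : Y n x -> eta n x < e ->
  exists pi : V -> R, forall p q, Y n.+1 p -> Y n.+1 q ->
    `|x - p| <= A * r n -> `|x - q| <= A * r n ->
    `|pi p - pi q| <= `|p - q| /\ `|p - q| <= `|pi p - pi q| + e * r n.
Proof.
move=> Yx xe.
have [pi piP] := jones_coordinate A_gt0 (r_gt0 n) (b_ge0 n x) (bE Yx) xe.
exists pi => p q Yp Yq xp xq; have [YK sep _] := nets n.+1.
apply: piP => //; [exact: YK|exact: YK|] => npq; rewrite -rS.
by apply: sep => //; exact/eqP.
Qed.

(** If a net point had infinitely many children, either one of them would be
flat, which bounds their number, or each would contribute at least a fixed
amount to the sum. *)
Lemma net_finite n : finite_set (Y n).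
Proof.
have A0 := A_gt0; elim: n => [|n IH]; first by have [x ->] := Y0; exact: finite_set1.
have r0 := r_gt0 n.+1; have rn : r n = 2 * r n.+1 by rewrite rS; lra.
have cover : Y n.+1 `<=` \bigcup_(x in Y n) [set y | Y n.+1 y /\ `|x - y| <= r n].
  move=> y Yy; have [_ _ cov] := nets n; have [YK _ _] := nets n.+1.
  by have [x Yx xy] := cov y (YK y Yy); exists x.
apply: (sub_finite_set cover); apply: bigcup_finite => // x Yx.
apply: contrapT => infY.
pose B1 : R := 2 * (2 * r n) / (7 / 8 * r n.+1) + 1.
pose B2 : R := T * (32 * A) / r n.+1.
have [F FY Fsize] := infinite_set_fset (Num.truncn (Num.max B1 B2)).+1 infY.
pose s : seq V := finmap.enum_fset F.
have us : uniq s by exact: finmap.fset_uniq.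
have sY y : y \in s -> Y n.+1 y /\ `|x - y| <= r n by move=> ys; apply: FY.
have {Fsize} : Num.max B1 B2 < (size s)%:R.
  by apply: (@lt_le_trans _ _ (Num.truncn (Num.max B1 B2)).+1%:R);
    rewrite ?truncnS_gt// ler_nat.
rewrite gt_max => /andP[s1 s2].
have [/hasP[y ys fy]|nf] := boolP (has (fun y => eta n.+1 y < 1 / 8) s).
  have [pi piP] := Y_coordinate (sY y ys).1 fy.
  have near p : p \in s -> `|y - p| <= 2 * r n.
    move=> ps; have [_ h1] := sY y ys; have [_ h2] := sY p ps.
    apply: le_trans (ler_distD x y p) _.
    by rewrite mulr_natl mulr2n lerD// distrC.
  have nearA p : p \in s -> `|y - p| <= A * r n.+1.
    move=> ps; apply: le_trans (near p ps) _; rewrite rn mulrA ler_wpM2r ?ltW//.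
    by have := HL; have := HA; lra.
  have pir p q : p \in s -> q \in s -> `|pi p - pi q| <= `|p - q| /\
      `|p - q| <= `|pi p - pi q| + 1 / 8 * r n.+1.
    move=> ps qs; apply: piP; [| |exact: nearA|exact: nearA].
      by have [/Ysub] := sY p ps.
    by have [/Ysub] := sY q qs.
  have : (count predT s)%:R <= B1.
    apply: (@count_separated R V s predT pi (pi y) (2 * r n)) => //; [lra|lra| |].
      move=> p ps _; have [h _] := pir p y ps ys; apply: le_trans h _.
      by rewrite distrC; exact: near.
    move=> p q ps qs _ _ /eqP npq; have [_ h] := pir p q ps qs.
    have [_ sep _] := nets n.+1.
    by have := sep p q (sY p ps).1 (sY q qs).1 npq; lra.
  by rewrite count_predT; lra.
have := @net_sum_le [seq (n.+1, y) | y <- s].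
rewrite map_inj_uniq; last by move=> y z [].
move=> /(_ us) h; have {}h : \sum_(y <- s) b n.+1 y ^+ 2 * (2 * (A * r n.+1)) <= T.
  by move: h; rewrite big_map; apply => i /mapP[y /sY[Yy _] ->].
have : (size s)%:R * (r n.+1 / (32 * A)) <= T.
  apply: le_trans h; rewrite -[size s]count_predT -sum1_countR mulr_suml.
  rewrite [leLHS]big_seq [leRHS]big_seq; apply: ler_sum => y ys; rewrite mul1r.
  have := hasPn nf y ys; rewrite -leNgt /eta => ly.
  rewrite ler_pdivrMr; last by rewrite mulr_gt0.
  have -> : b n.+1 y ^+ 2 * (2 * (A * r n.+1)) * (32 * A) =
     8 * (8 * A ^+ 2 * b n.+1 y ^+ 2) * r n.+1 by ring.
  by rewrite ler_peMl ?(ltW r0)//; lra.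
move: s2; rewrite /B2 ltr_pdivrMr// => s2 h'.
have : (size s)%:R * (r n.+1 / (32 * A)) * (32 * A) <= T * (32 * A).
  by rewrite ler_wpM2r// mulr_ge0// ltW.
rewrite -mulrA divfK; last by apply: lt0r_neq0; rewrite mulr_gt0.
lra.
Qed.

Lemma connected_hull : exists G : set V, [/\ connected G, K `<=` G &
  (hausdorff1 G <= ((4 * L + 2) * (graph_cost L * (r 0 + 4 * A * T)))%:E)%E].
Proof.
have hL := HL; have hA := HA; have A0 := A_gt0.
have lists n : exists s : seq V, uniq s /\ forall x, x \in s <-> Y n x.
  have [F FE] := finite_fsetP.1 (net_finite n).
  by exists (finmap.enum_fset F); rewrite finmap.fset_uniq FE.
have {lists} [xs xsP] := choice lists.
have us n : uniq (xs n) by have [] := xsP n.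
have xsY n x : x \in xs n <-> Y n x by have [_] := xsP n; apply.
have xsub n : {subset xs n <= xs n.+1} by move=> x /xsY/Ysub/xsY.
have sep n x y : x \in xs n -> y \in xs n -> x != y -> r n < `|x - y|.
  by move=> /xsY Yx /xsY Yy /eqP; have [_ s _] := nets n; exact: s.
have xsK n x : x \in xs n -> K x by move=> /xsY; have [YK _ _] := nets n; exact: YK.
have covK n y : K y -> exists2 x, x \in xs n & `|x - y| <= r n.
  by have [_ _ cov] := nets n; move=> /cov[x /xsY]; exists x.
have cov n y : y \in xs n.+1 -> exists2 x, x \in xs n & `|y - x| <= r n.
  by move=> /xsK/(covK n)[x xn xy]; exists x; rewrite // distrC.
have xs0 : exists x, xs 0%N = [:: x].
  have [x Y0x] := Y0; exists x; apply: perm_small_eq => //.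
  apply: uniq_perm => // y; rewrite inE; apply/idP/eqP.
    by move/xsY; rewrite Y0x.
  by move=> ->; apply/xsY; rewrite Y0x.
have ch n x e : x \in xs n -> eta n x < e -> exists pi : V -> R,
    chart (fun x y : V => `|x - y|) (xs n.+1) x (A * r n) (e * r n) pi.
  move=> /xsY Yx xe; have [pi piP] := Y_coordinate Yx xe; exists pi => p q.
  by move=> /xsY Yp /xsY Yq; exact: piP.
have eta0 n x : 0 <= eta n x by rewrite !mulr_ge0 ?sqr_ge0// ltW.
have [ed [ed1 ed2 ed3]] := @nets_graph R V (fun x y : V => `|x - y|) xs r eta A L
   (fun x => etrans (congr1 Num.norm (subrr x)) (@normr0 _ _)) (@distrC _ _)
     (@ler_distD _ _)
   r_gt0 rS us xsub sep cov xs0 eta0 ch HL HA HLbig.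
pose M := graph_cost L * (r 0%N + 4 * A * T).
have g0 : 0 <= graph_cost L :> R by exact: graph_cost_ge0.
have tot N : \sum_(n < N.+1) \sum_(e <- ed n) `|e.1 - e.2| + (size (xs N))%:R * r N <= M.
  apply: le_trans (ed2 N) _; rewrite ler_wpM2l// lerD2l.
  pose s := [seq (n, x) | n <- iota 0 N.+1, x <- xs n].
  have uniq_s : uniq s.
    apply: allpairs_uniq_dep; [exact: iota_uniq|by move=> n _; exact: us|].
    by move=> [m x] [n y] _ _ /= [-> ->].
  have sY i : i \in s -> Y i.1 i.2.
    by move=> /allpairsPdep[n [x [_ xn ->]]]; exact/xsY.
  have -> : \sum_(n < N.+1) defect xs r eta n =
      4 * A * \sum_(i <- s) b i.1 i.2 ^+ 2 * (2 * (A * r i.1)).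
    rewrite /s big_allpairs_dep -[iota _ _]/(index_iota 0 N.+1) big_mkord mulr_sumr.
    apply: eq_bigr => n _; rewrite mulr_sumr; apply: eq_bigr => x _ /=.
    by rewrite /eta; ring.
  by rewrite ler_wpM2l ?net_sum_le// mulr_ge0// ltW.
have L1 : 1 <= L by lra.
exists (limit_set K ed); split.
- exact: (limit_set_connected (@ell2_complete R) r_gt0 rS xsK covK L1 ed1 tot ed3).
- by move=> x Kx; apply: subset_closure; left.
- exact: (limit_set_hausdorff1 r_gt0 rS xsK covK L1 ed1 tot).
Qed.

End Assembly.

Theorem theorem1p5 (R : realType) :
  exists A0 : R, forall A : R, 1 < A -> A0 < A ->
  exists C : R, forall (K : set (ell2 R)) (n0 : int) (X : int -> set (ell2 R)),
    (diam K <= (2 ^ (- n0))%:E)%E ->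
    (forall n : int, n0 <= n -> is_net (2 ^ (- n)) K (X n)) ->
    (forall n : int, n0 <= n -> X n `<=` X (n + 1)) ->
  exists Gamma0 : set (ell2 R),
    [/\ connected Gamma0, K `<=` Gamma0
      & (hausdorff1 Gamma0 <=
           C%:E * (diam K + \esum_(Q in multires A n0 X)
                              (jones_beta K Q ^+ 2 * diam Q)))%E].
Proof.
pose L : R := 4 * end_cost.
have HL : 20 <= L by rewrite /L /end_cost; lra.
(* the ball of a net point has to contain all the points compared in its chart *)
exists (40 * L) => A A1 /ltW HA; have A0 : 0 < A by lra.
have g0 : 0 <= graph_cost L :> R by exact: graph_cost_ge0.
pose C := (4 * L + 2) * (graph_cost L * (4 * A)) + 1.
have C0 : 0 < C.
  by rewrite ltr_wpDl// mulr_ge0 ?mulr_ge0//; lra.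
exists C => K n0 X dK nets Xsub.
set S := \esum_(Q in _) _.
have S0 : (0 <= S)%E.
  apply: esum_ge0 => Q _; apply: mule_ge0; last exact: diam_ge0.
  rewrite expe2; have [j0|/ltW j0] := leP 0%E (jones_beta K Q); first exact: mule_ge0.
  exact: mule_le0.
have dK0 : (0 <= diam K)%E by exact: diam_ge0.
have [K0|[x0 Kx0]] : K = set0 \/ exists x, K x.
    by have [->|/set0P] := eqVneq K set0; [left|right].
  exists set0; split; [exact: connected0|by rewrite K0|].
  apply: (@le_trans _ _ 0%E); last by rewrite mule_ge0 ?adde_ge0// lee_fin ltW.
  apply: ge_ereal_sup => _ [delta /= d0 <-].
  by have := @hausdorff1_cover R (ell2 R) set0 [::] delta; rewrite big_nil; apply.
have dfin : diam K \is a fin_num.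
  by rewrite ge0_fin_numE// (le_lt_trans dK)// ltry.
pose D := fine (diam K); have DE : diam K = D%:E by rewrite fineK.
have KD x y : K x -> K y -> `|x - y| <= D by move=> Kx Ky; rewrite -lee_fin -DE diam_ge.
have D0 : 0 <= D by exact: fine_ge0.
have [D00|Dpos] := eqVneq D 0.
  have K1 : K = [set x0].
    apply/seteqP; split=> [x Kx|x ->//]; apply/eqP; rewrite -subr_eq0 -normr_le0 -D00.
    exact: KD.
  exists K; split=> //; first by rewrite K1; exact: connected1.
  apply: (@le_trans _ _ 0%E); last by rewrite mule_ge0 ?adde_ge0// lee_fin ltW.
  apply: ge_ereal_sup => _ [delta /= d0 <-].
  have := @hausdorff1_cover R (ell2 R) K [:: (x0, 0)] delta.
  rewrite big_seq1 /= mulr0; apply=> //.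
    by move=> b; rewrite inE => /eqP-> /=; rewrite mulr0 (ltW d0).
  by move=> x; rewrite K1 => ->; exists (x0, 0); rewrite ?mem_head//= subrr normr0.
have {}Dpos : 0 < D by rewrite lt_def Dpos.
have [Sfin|Sinf] := boolP (S \is a fin_num); last first.
  exists setT; split=> //.
    rewrite (_ : setT = \bigcup_(x in [set: ell2 R]) segm 0 x); last first.
      by apply/seteqP; split=> // x _; exists x => //; exact: segm_r.
    apply: bigcup_connected; last by move=> x _; exact: segm_connected.
    by exists 0 => x _; exact: segm_l.
  have -> : S = +oo%E by move: Sinf; rewrite ge0_fin_numE// -leNgt leye_eq => /eqP.
  by rewrite addey ?gt0_muley ?leey// -ltNye (lt_le_trans _ dK0).
pose r (n : nat) : R := 2 ^ (- (n0 + n%:Z)).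
have r0 n : 0 < r n by rewrite /r exprz_gt0.
have rS n : r n.+1 = r n / 2.
  by rewrite /r intS addrCA opprD expfzDr ?pnatr_eq0// exprN1 mulrC.
(* start at the last scale not smaller than [diam K]: the net is still one point, and
   the first scale costs at most [2 * diam K] *)
have [k [Dk kD]] : exists k, D <= r k /\ r k.+1 < D.
  have ex : exists N, r N < D.
    by have [N h] := halving_lt r0 rS Dpos; exists N; exact: h.
  have := ex_minnP ex; case=> -[|k] rk kmin.
    by move: dK; rewrite DE lee_fin => h; move: rk; rewrite /r addr0 ltNge h.
  exists k; split=> //; rewrite leNgt; apply/negP => /kmin; by rewrite ltnn.
have le_m n : n0 <= n0 + k%:Z + n%:Z by rewrite -addrA lerDl.
have Y0 : exists x, X (n0 + k%:Z + 0%:Z) = [set x].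
  have [YK sep cov] := nets _ (le_m 0%N); have [x Yx _] := cov x0 Kx0.
  exists x; apply/seteqP; split=> [y Yy|y ->//]; apply: contrapT => yx.
  have := sep y x Yy Yx yx; have := KD y x (YK y Yy) (YK x Yx); rewrite addr0.
  by move: Dk; rewrite /r; lra.
have Ysub n : X (n0 + k%:Z + n%:Z) `<=` X (n0 + k%:Z + n.+1%:Z).
  by rewrite intS [1 + _]addrC addrA; exact: Xsub.
have tail_sum : (\esum_(Q in multires A (n0 + k%:Z) X) (jones_beta K Q ^+ 2 * diam Q)
    <= (fine S)%:E)%E.
  rewrite fineK//; apply: ge_ereal_sup => _ [F [Ffin Fsub] <-].
  apply: ereal_sup_ubound; exists F => //; split=> // Q /Fsub[n [x [kn Xx ->]]].
  by exists n, x; split=> //; apply: le_trans kn; rewrite lerDl.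
have [G [Gc KG GH]] := connected_hull HL (lexx _) HA (fun n => nets _ (le_m n)) Ysub Y0
  tail_sum.
exists G; split=> //; apply: le_trans GH _.
rewrite DE -[S]fineK// -EFinD -EFinM lee_fin addr0 -/(r k).
have T0 : 0 <= fine S by exact: fine_ge0.
have h1 : r k + 4 * A * fine S <= 4 * A * (D + fine S).
  have : 1 * D <= A * D by rewrite ler_wpM2r// ltW.
  by move: kD; rewrite rS; lra.
have h2 : graph_cost L * (r k + 4 * A * fine S) <= graph_cost L * (4 * A * (D + fine S)).
  by rewrite ler_wpM2l.
have h3 : (4 * L + 2) * (graph_cost L * (r k + 4 * A * fine S)) <=
    (4 * L + 2) * (graph_cost L * (4 * A * (D + fine S))).
  by rewrite ler_wpM2l//; lra.
apply: (le_trans h3).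
have -> : C * (D + fine S) =
    (4 * L + 2) * (graph_cost L * (4 * A * (D + fine S))) + (D + fine S).
  by rewrite /C; ring.
by rewrite lerDl addr_ge0.
Qed.
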